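(* Let $G=(V,E)$ be a finite graph, let $p,q,r\in\mathbb{R}$, and let $H=(H(n))_{n\in\mathbb{N}}$ be the non conservative zero range process on $G$ with parameters $p,q,r$ started from a non-zero configuration $H(0)\in\mathbb{N}^V$. Then: \begin{enumerate} \item if $p\le 1+\max\{q,r\}$, then $\mathbb{P}(\mathrm{Creat})=0$; \item if $p>1+\max\{q,r,0\}$, then $\mathbb{P}(\mathrm{Creat})=1$ and $\mathbb{P}(\mathrm{Mon})=1$. \end{enumerate}
   Context: $\mathbb{N}=\{0,1,2,\dots\}$. All graphs are undirected, connected, without loops and without parallel edges; $u\sim v$ means that $\{u,v\}$ is an edge, and $\deg(v)$ is the number of edges at $v$. For $\eta=(\eta_w)_{w\in V}\in\mathbb{N}^V$ and $v\in V$: $\eta^{+v}$ is obtained from $\eta$ by replacing $\eta_v$ by $\eta_v+1$; if $\eta_v\ge1$, $\eta^{-v}$ is obtained by replacing $\eta_v$ by $\eta_v-1$; if $\eta_v\geq 1$ and $u\sim v$, $\eta^{vu}$ is obtained by replacing $\eta_v$ by $\eta_v-1$ and $\eta_u$ by $\eta_u+1$. The non conservative zero range process with parameters $p,q,r\in\mathbb{R}$ is the Markov chain $H=(H(n))_{n\in\mathbb{N}}$ on $\mathbb{N}^V$ with $H(0)$ non-zero and transition probabilities $$\mathbb{P}[H(n+1)=\eta^{+v}\mid H(n)=\eta]=\frac{\eta_v^p}{Z(\eta)},\quad \mathbb{P}[H(n+1)=\eta^{-v}\mid H(n)=\eta]=\frac{\eta_v^q}{Z(\eta)},\quad \mathbb{P}[H(n+1)=\eta^{vu}\mid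 H(n)=\eta]=\frac{\eta_v^r}{Z(\eta)}\ (u\sim v),$$ where $Z(\eta)=\sum_{w\in V}\big[\eta_w^p+\eta_w^q+\deg(w)\eta_w^r\big]$. The following convention is used for the value at $0$: the creation weight is $0^p=1$, the annihilation weight is $0^q=0$ and the jump weight is $0^r=0$ (whatever the numerical values of $p,q,r$). $\mathrm{Creat}$ is the event that there exists $m\in\mathbb{N}$ such that for each $n\ge m$ there is a vertex $v(n)\in V$ with $H(n+1)=H(n)^{+v(n)}$. $\mathrm{Mon}$ is the event that there exist a unique site $w\in V$ and a time $m\in\mathbb{N}$ such that for all $n\ge m$ one has $H_w(n+1)=H_w(n)+1$ and $H_v(n+1)=H_v(n)$ for all $v\ne w$.
   Formalization: In item 1, if G has a single vertex, the condition p ≤ 1+q is additionally required: with no edges r plays no role, and for p > 1+q one has P(Creat) > 0 (e.g. p=0, q=-10, r=10), so item 1 fails as literally stated. *)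

(* Defs.v *)
From HB Require Import structures.
From mathcomp Require Import all_boot all_order all_algebra.
From mathcomp Require Import all_classical all_reals all_analysis.
From mathcomp Require Import zify.

Set Implicit Arguments.
Unset Strict Implicit.
Unset Printing Implicit Defensive.
Import Order.TTheory GRing.Theory Num.Theory.
Local Open Scope classical_set_scope.
Local Open Scope ring_scope.

(* A finite simple connected graph on the vertex set [V] is given by its
   adjacency relation. *)
Definition simple_connected_graph (V : finType) (e : rel V) : Prop :=
  [/\ symmetric e, irreflexive e & forall u v : V, connect e u v].

Definition degree (V : finType) (e : rel V) (v : V) : nat := #|[pred u | e v u]|.

Definition conf (V : finType) := {ffun V -> nat}.

Definition conf0 (V : finType) : conf V := [ffun=> 0%N].

Definition create (V : finType) (eta : conf V) (v : V) : conf V :=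
  [ffun w => if w == v then (eta w).+1 else eta w].

(* Only meaningful for [0 < eta v]; otherwise the move has weight 0 below. *)
Definition annihilate (V : finType) (eta : conf V) (v : V) : conf V :=
  [ffun w => if w == v then (eta w).-1 else eta w].

(* A particle goes from [v] to [u]; same caveat when [eta v = 0]. *)
Definition jump (V : finType) (eta : conf V) (v u : V) : conf V :=
  create (annihilate eta v) u.

(* The weights [k ^ a] with the conventions at [k = 0]: 1 for a creation, 0 for
   an annihilation or a jump, whatever the exponent ([powR] would give
   [0 `^ a = (a == 0)%:R]). *)
Definition creation_weight (R : realType) (a : R) (k : nat) : R :=
  if k == 0%N then 1 else k%:R `^ a.

Definition removal_weight (R : realType) (a : R) (k : nat) : R :=
  if k == 0%N then 0 else k%:R `^ a.

Definition zrp_Z (R : realType) (V : finType) (e : rel V) (p q r : R)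
    (eta : conf V) : R :=
  \sum_(w : V) (creation_weight p (eta w) + removal_weight q (eta w)
                + (degree e w)%:R * removal_weight r (eta w)).

(* The transition matrix, as the normalized sum of the weights of all the moves
   leading from [eta] to [xi]. Distinct moves of positive weight have distinct
   targets: see [zrp_kernel_create], [zrp_kernel_annihilate] and
   [zrp_kernel_jump]. *)
Definition zrp_kernel (R : realType) (V : finType) (e : rel V) (p q r : R)
    (eta xi : conf V) : R :=
  (\sum_(v : V) (xi == create eta v)%:R * creation_weight p (eta v)
   + \sum_(v : V) (xi == annihilate eta v)%:R * removal_weight q (eta v)
   + \sum_(v : V) \sum_(u : V | e v u)
       (xi == jump eta v u)%:R * removal_weight r (eta v))
  / zrp_Z e p q r eta.

(* [X] is a Markov chain with transition matrix [Q] and arbitrary initial law.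
   The path formula below is the Markov property
   P[X_{n+1} = x_{n+1} | X_0 = x_0, ..., X_n = x_n] = Q x_n x_{n+1}
   multiplied by the probability of the conditioning event, which may be 0.
   When [S] is countable, the measurability clause says that every [X n] is
   measurable for the discrete sigma-algebra. *)
Definition markov_chain (R : realType) (d : measure_display)
    (T : measurableType d) (P : probability T R) (S : Type) (Q : S -> S -> R)
    (X : nat -> T -> S) : Prop :=
  (forall (n : nat) (x : S), measurable [set t | X n t = x]) /\
  (forall (n : nat) (x : nat -> S),
     P [set t | forall k : nat, (k <= n.+1)%N -> X k t = x k] =
     (P [set t | forall k : nat, (k <= n)%N -> X k t = x k]
      * (Q (x n) (x n.+1))%:E)%E).

Definition zero_range_process (R : realType) (V : finType) (e : rel V)
    (p q r : R) (d : measure_display) (T : measurableType d)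
    (P : probability T R) (H : nat -> T -> conf V) : Prop :=
  markov_chain P (zrp_kernel e p q r) H /\
  P [set t | H 0%N t = conf0 V] = 0%E.

Definition Creat (V : finType) (T : Type) (H : nat -> T -> conf V) : set T :=
  [set t | exists m : nat, forall n : nat, (m <= n)%N ->
     exists v : V, H n.+1 t = create (H n t) v].

Definition Mon (V : finType) (T : Type) (H : nat -> T -> conf V) : set T :=
  [set t | exists! w : V, exists m : nat, forall n : nat, (m <= n)%N ->
     H n.+1 t w = (H n t w).+1 /\
     forall v : V, v != w -> H n.+1 t v = H n t v].

Section ZrpKernel.
Variables (R : realType) (V : finType) (e : rel V) (p q r : R).
Implicit Types (eta : conf V) (u v : V).

Lemma create_inj eta : injective (create eta).
Proof.
move=> v v' /ffunP /(_ v); rewrite !ffunE eqxx; case: eqVneq => // _ /eqP.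
by rewrite -[X in _ == X]addn0 -addn1 eqn_add2l.
Qed.

Definition mass eta := (\sum_w eta w)%N.

Lemma mass_create eta v : mass (create eta v) = (mass eta).+1.
Proof.
rewrite /mass (bigD1 v) //= [in RHS](bigD1 v) //= ffunE eqxx addSn.
by congr (_ + _).+1; apply: eq_bigr => w /negPf nwv; rewrite ffunE nwv.
Qed.

Lemma create_annihilate eta v :
  (0 < eta v)%N -> create (annihilate eta v) v = eta.
Proof.
move=> h; apply/ffunP => w; rewrite !ffunE.
by case: eqP => // ->; rewrite prednK.
Qed.

Lemma mass_annihilate eta v :
  (0 < eta v)%N -> (mass (annihilate eta v)).+1 = mass eta.
Proof. by move=> h; rewrite -(mass_create _ v) create_annihilate. Qed.

Lemma mass_jump eta v u : (0 < eta v)%N -> mass (jump eta v u) = mass eta.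
Proof. by move=> h; rewrite mass_create mass_annihilate. Qed.

Lemma annihilate_inj eta v v' : (0 < eta v)%N ->
  annihilate eta v = annihilate eta v' -> v = v'.
Proof.
move=> h /ffunP /(_ v); rewrite !ffunE eqxx; case: eqVneq => // _ E.
by case: (eta v) h E => //= n _ /n_Sn.
Qed.

Lemma jump_inj eta v u v' u' : (0 < eta v)%N -> v != u -> v' != u' ->
  jump eta v u = jump eta v' u' -> v = v' /\ u = u'.
Proof.
move=> h nvu nvu' E; have vv' : v = v'.
  move/ffunP: E => /(_ v); rewrite !ffunE eqxx (negPf nvu).
  case: (eqVneq v v') => // _; case: (v == u') => E.
    by move: h; rewrite -ltnS -E; case: (eta v) => [//|n]; lia.
  by move: h E; case: (eta v) => //= n _ /n_Sn.
by subst v'; split=> //; exact: create_inj E.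
Qed.

Lemma removal_weight_eq0 (a : R) k : ~~ (0 < k)%N -> removal_weight a k = 0.
Proof. by rewrite -eqn0Ngt /removal_weight => ->. Qed.

Lemma creation_weight_gt0 (a : R) k : 0 < creation_weight a k.
Proof.
by rewrite /creation_weight; case: k => [|k] //=; rewrite powR_gt0 ?ltr0n.
Qed.

Lemma removal_weight_ge0 (a : R) k : 0 <= removal_weight a k.
Proof. by rewrite /removal_weight; case: ifP => // _; exact: powR_ge0. Qed.

Lemma zrp_Z_gt0 eta (v0 : V) : 0 < zrp_Z e p q r eta.
Proof.
have pos w : 0 < creation_weight p (eta w) + removal_weight q (eta w)
                 + (degree e w)%:R * removal_weight r (eta w).
  rewrite ltr_wpDr ?mulr_ge0 ?ler0n ?removal_weight_ge0 //.
  by rewrite ltr_wpDr ?removal_weight_ge0 ?creation_weight_gt0.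
rewrite /zrp_Z (bigD1 v0) //= ltr_wpDr //.
by apply: sumr_ge0 => w _; exact: ltW.
Qed.

Lemma zrp_kernel_create eta v :
  zrp_kernel e p q r eta (create eta v) =
  creation_weight p (eta v) / zrp_Z e p q r eta.
Proof.
rewrite /zrp_kernel; congr (_ / _).
rewrite (bigD1 v) //= eqxx mul1r big1 ?addr0; last first.
  by move=> w /negPf nwv; rewrite (inj_eq (@create_inj eta)) eq_sym nwv mul0r.
rewrite [X in _ + X + _]big1 ?[X in _ + X]big1 ?addr0 // => w _.
  apply: big1 => u _; have [h|h] := boolP (0 < eta w)%N; last first.
    by rewrite removal_weight_eq0 // mulr0.
  case: eqP => [/(congr1 mass)|]; last by rewrite mul0r.
  by rewrite mass_create mass_jump // => /esym /n_Sn.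
have [h|h] := boolP (0 < eta w)%N; last by rewrite removal_weight_eq0 // mulr0.
case: eqP => [/(congr1 mass)|]; last by rewrite mul0r.
by rewrite mass_create; have := mass_annihilate h; lia.
Qed.

Lemma zrp_kernel_annihilate eta v : (0 < eta v)%N ->
  zrp_kernel e p q r eta (annihilate eta v) =
  (eta v)%:R `^ q / zrp_Z e p q r eta.
Proof.
move=> hv; rewrite /zrp_kernel; congr (_ / _).
rewrite big1 ?add0r; last first.
  move=> w _; case: eqP => [/(congr1 mass)|]; last by rewrite mul0r.
  by rewrite mass_create; have := mass_annihilate hv; lia.
rewrite (bigD1 v) //= eqxx mul1r {1}/removal_weight gtn_eqF //.
rewrite big1 ?[X in _ + X]big1 ?addr0 // => w.
  move=> _; apply: big1 => u _; have [h|h] := boolP (0 < eta w)%N; last first.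
    by rewrite removal_weight_eq0 // mulr0.
  case: eqP => [/(congr1 mass)|]; last by rewrite mul0r.
  by rewrite mass_jump //; have := mass_annihilate hv; lia.
move=> nwv; case: eqP => [/(annihilate_inj hv)/esym/eqP|]; last by rewrite mul0r.
by rewrite (negPf nwv).
Qed.

Lemma zrp_kernel_jump eta v u : irreflexive e -> e v u -> (0 < eta v)%N ->
  zrp_kernel e p q r eta (jump eta v u) =
  (eta v)%:R `^ r / zrp_Z e p q r eta.
Proof.
move=> irr evu hv; rewrite /zrp_kernel; congr (_ / _).
have ne x y : e x y -> x != y by move=> exy; apply/eqP => E; rewrite E irr in exy.
rewrite big1 ?add0r; last first.
  move=> w _; case: eqP => [/(congr1 mass)|]; last by rewrite mul0r.
  by rewrite mass_create mass_jump // => /n_Sn.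
rewrite big1 ?add0r; last first.
  move=> w _; have [h|h] := boolP (0 < eta w)%N; last first.
    by rewrite removal_weight_eq0 // mulr0.
  case: eqP => [/(congr1 mass)|]; last by rewrite mul0r.
  by rewrite mass_jump //; have := mass_annihilate h; lia.
rewrite (bigD1 v) //= (bigD1 u) //= eqxx mul1r {1}/removal_weight gtn_eqF //.
rewrite big1 ?addr0; last first.
  move=> w /andP[evw nwu]; case: eqP; last by rewrite mul0r.
  by move=> /(jump_inj hv (ne _ _ evu) (ne _ _ evw))[_ /esym/eqP]; rewrite (negPf nwu).
rewrite big1 ?addr0 // => w nwv; apply: big1 => x ewx.
case: eqP; last by rewrite mul0r.
by move=> /(jump_inj hv (ne _ _ evu) (ne _ _ ewx))[/esym/eqP]; rewrite (negPf nwv).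
Qed.

End ZrpKernel.

(* Main.v *)
Require Import Defs.
From mathcomp Require Import all_boot all_order all_algebra.
From mathcomp Require Import all_classical all_reals all_analysis.
From mathcomp Require Import ring lra zify.

Set Implicit Arguments.
Unset Strict Implicit.
Unset Printing Implicit Defensive.
Import Order.TTheory GRing.Theory Num.Theory.
Import numFieldNormedType.Exports.
Local Open Scope classical_set_scope.
Local Open Scope ring_scope.

(* Write M for the number of particles.

   If p <= 1 + max(q, r), then k^p <= M (k^q + deg k^r) at every occupied site.
   On Creat, all late creations take place at occupied sites, and such a step has
   conditional probability at most M / (M + 1). As M grows by one at each step,
   the product telescopes to M / (M + j) and tends to 0.

   If p > 1 + max(q, r, 0), then the relative weight of annihilations and jumps is
   O(M^-s) with s > 1. Hence from every configuration only creations occur with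
   probability at least some dl > 0 independent of the configuration, and k + 1
   other moves occur with probability at most (1 - dl)^(k + 1).
   As long as only creations occur, the chain is dominated by the urn with weights
   c(k) = k^p. For two sites with counts x and y, and for every real th, the real part of
     prod_(j < x) (1 + i th / c(j)) * prod_(j < y) (1 - i th / c(j))
   is harmonic for the urn. Since sum 1 / c(j) converges, it tends to a limit K as
   both x and y grow, whereas its quotient by K tends to 0 as th grows as long as
   min(x, y) stays bounded. So both counts cannot diverge with positive
   probability, and a single site receives all late creations. *)

(** * Probabilities as real numbers *)

Section RealProbability.
Context {R : realType} {d : measure_display} {T : measurableType d}
  (P : probability T R).

Definition pr (A : set T) : R := fine (P A).

Lemma prE A : measurable A -> P A = (pr A)%:E.
Proof. by move=> mA; rewrite /pr fineK // fin_num_measure. Qed.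

Lemma pr_ge0 A : 0 <= pr A.
Proof. by rewrite /pr fine_ge0. Qed.

Lemma pr_le A B : measurable A -> measurable B -> A `<=` B -> pr A <= pr B.
Proof.
move=> mA mB AB; rewrite -lee_fin -!prE //.
by apply: le_measure; rewrite ?inE.
Qed.

Lemma pr_le1 A : measurable A -> pr A <= 1.
Proof. by move=> mA; rewrite -lee_fin -prE // probability_le1. Qed.

Lemma pr_set0 : pr set0 = 0.
Proof. by rewrite /pr measure0. Qed.

Lemma pr_setU A B : measurable A -> measurable B -> [disjoint A & B] ->
  pr (A `|` B) = pr A + pr B.
Proof.
move=> mA mB /disj_setPS AB; apply: EFin_inj.
rewrite EFinD -!prE //; last exact: measurableU.
by rewrite measureU //; apply/seteqP; split.
Qed.

Lemma pr_setU_le A B : measurable A -> measurable B ->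
  pr (A `|` B) <= pr A + pr B.
Proof.
move=> mA mB; rewrite -lee_fin EFinD -!prE //; last exact: measurableU.
exact: measureU2.
Qed.

Lemma pr_bigcup_fin (I : finType) (F : I -> set T) :
  (forall i, measurable (F i)) -> trivIset setT F ->
  measurable (\bigcup_i F i) /\ pr (\bigcup_i F i) = \sum_i pr (F i).
Proof.
move=> mF tF; have -> : \bigcup_i F i = \bigcup_(i in [set` enum I]) F i.
  by apply: eq_bigcupl; split=> i //= _; rewrite mem_enum.
rewrite -big_enum /=; elim: (enum I) (enum_uniq I) => [|i s IH] /=.
  by rewrite set_nil bigcup_set0 big_nil pr_set0.
case/andP=> nis /IH[mU eU]; rewrite big_cons.
have -> : [set` i :: s] = i |` [set` s].
  by apply/seteqP; split=> j /=; rewrite inE => /predU1P.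
rewrite bigcup_setU1.
split; first exact: measurableU.
rewrite pr_setU ?eU //; apply/disj_setPS => t [Fi] [j /= js Fj].
by move: nis; rewrite (tF i j) ?js //; exists t.
Qed.

Lemma pr_bigcup_le (I : finType) (Q : pred I) (F : I -> set T) A :
  measurable A -> (forall i, measurable (F i)) ->
  (forall t, A t -> exists2 i, Q i & F i t) -> pr A <= \sum_(i | Q i) pr (F i).
Proof.
move=> mA mF AF.
have [mU le] : measurable (\big[setU/set0]_(i | Q i) F i) /\
  pr (\big[setU/set0]_(i | Q i) F i) <= \sum_(i | Q i) pr (F i).
  elim/big_ind2 : _ => [|r1 B r2 C [m1 l1] [m2 l2]|i _].
  - by rewrite pr_set0.
  - split; first exact: measurableU.
    by apply: (le_trans (pr_setU_le _ _)) => //; exact: lerD.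
  - by [].
apply: le_trans le; apply: pr_le => // t /AF[i Qi Fi].
by rewrite (bigD1 i) //=; left.
Qed.

Lemma pr_nondecreasing (F : nat -> set T) (c : R) :
  (forall j, measurable (F j)) -> (forall j, F j `<=` F j.+1) ->
  (forall j, pr (F j) <= c) -> pr (\bigcup_j F j) <= c.
Proof.
move=> mF ndF Fc; have mU : measurable (\bigcup_j F j) by exact: bigcup_measurable.
rewrite -lee_fin -prE //.
have cvgF : P (F j) @[j --> \oo] --> P (\bigcup_j F j).
  apply: nondecreasing_cvg_mu => //.
  by apply/nondecreasing_seqP => j; apply/subsetPset.
rewrite -(cvg_lim _ cvgF) //; apply: lime_le; first by apply/cvg_ex; eexists; exact: cvgF.
by near=> j; rewrite prE // lee_fin.
Unshelve. all: by end_near. Qed.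

Lemma pr_null_bigcup (S : countType) (F : S -> set T) A :
  measurable A -> (forall s, measurable (F s)) -> A `<=` \bigcup_s F s ->
  (forall s, pr (F s) = 0) -> pr A = 0.
Proof.
move=> mA mF AF F0; suff: P.-negligible A by move/(measure_negligible mA); rewrite /pr => ->.
apply: (negligibleS AF).
have -> : \bigcup_s F s = \bigcup_i (oapp F set0 (unpickle i)).
  apply/seteqP; split => [t [s _ Fs]|t [i _]].
    by exists (pickle s) => //; rewrite pickleK.
  by case: (unpickle i) => //= s Fs; exists s.
apply: negligible_bigcup => i; case: (unpickle i) => /= [s|].
  by apply/negligibleP; rewrite // -[LHS]/(P _) prE // F0.
exact: negligible_set0.
Qed.

(** Countable additivity over the fibres of [Y], numbered through [pickle] so that the sums are
    series over [nat]. It serves to condition on a state about which nothing is known. *)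
Lemma pr_fiber_le (S : countType) (Y : T -> S) (A B : set T) (c : R) :
  0 <= c -> measurable A -> measurable B ->
  (forall s, measurable [set t | Y t = s]) ->
  (forall s, pr (A `&` [set t | Y t = s]) <= c * pr (B `&` [set t | Y t = s])) ->
  pr A <= c * pr B.
Proof.
move=> c0 mA mB mY le.
pose F i := [set t | pickle (Y t) = i].
have FE i : F i = set0 \/ exists s, F i = [set t | Y t = s].
  have [[s si]|ns] := pselect (exists s : S, pickle s = i); [right|left].
    by exists s; apply/seteqP; split=> t; rewrite /F /= -si; [move/(pcan_inj pickleK)|move->].
  by apply/seteqP; split=> // t /= Yi; apply: ns; exists (Y t).
have mF i : measurable (F i) by case: (FE i) => [|[s]] ->.
have decomp C : measurable C -> P C = (\sum_(i <oo) P (C `&` F i))%E.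
  move=> mC; transitivity (P (\bigcup_i (C `&` F i))).
    congr (P _); rewrite -setI_bigcupr; apply/seteqP; split=> [t Ct|t []//].
    by split=> //; exists (pickle (Y t)).
  rewrite measure_bigcup; first by apply: eq_eseriesl => i; rewrite in_setT.
    by move=> i _; exact: measurableI.
  by move=> i j _ _ [t [[_ <-] [_ <-]]].
rewrite -lee_fin EFinM -!prE // !decomp // -nneseriesZl //.
apply: lee_nneseries => // i _; have mI := fun C mC => measurableI C _ mC (mF i).
rewrite !prE //; [|exact: mI..]; rewrite -EFinM lee_fin.
by case: (FE i) => [->|[s ->]] //; rewrite !setI0 pr_set0 mulr0.
Qed.
End RealProbability.

(** * Markov chains on a countable set *)

Section MarkovChain.
Context {R : realType} {d : measure_display} {T : measurableType d}
  {P : probability T R} {S : countType} {Q : S -> S -> R} {X : nat -> T -> S}.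
Hypothesis mcX : markov_chain P Q X.
Local Notation pr := (pr P).

Definition cyl (x : nat -> S) (n : nat) : set T :=
  [set t | forall k, (k <= n)%N -> X k t = x k].

(** [cyl x n] reads [x] up to time [n] only, so overwriting one value of a full sequence is enough
    to prolong a prefix. *)
Definition extend (x : nat -> S) (n : nat) (s : S) : nat -> S :=
  fun k => if k == n.+1 then s else x k.

Lemma extend_last x n s : extend x n s n.+1 = s.
Proof. by rewrite /extend eqxx. Qed.

Lemma cyl_extend x n s : cyl (extend x n s) n.+1 = cyl x n `&` [set t | X n.+1 t = s].
Proof.
apply/seteqP; split=> t /=.
  move=> h; split; last by rewrite h // extend_last.
  by move=> k kn; rewrite h ?(leqW kn) // /extend ltn_eqF.
case=> h hs k; rewrite leq_eqVlt /extend; case: eqP => [-> //|_ /=].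
by rewrite ltnS; exact: h.
Qed.

Lemma measurable_state n s : measurable [set t | X n t = s].
Proof. by case: mcX => + _; apply. Qed.

(* Countably many values of the prefix, so that any condition on it is measurable. *)
Lemma measurable_prefix m (A : set T) :
  (forall t t', (forall k, (k <= m)%N -> X k t = X k t') -> A t -> A t') ->
  measurable A.
Proof.
move=> hA; pose pre t := [seq X k t | k <- iota 0 m.+1].
have preE t t' : pre t = pre t' -> forall k, (k <= m)%N -> X k t = X k t'.
  move=> /eq_in_map e k km; apply: e; by rewrite mem_iota add0n ltnS km.
have mpre s : measurable [set t | pre t = s].
  rewrite /pre; elim: (iota 0 m.+1) s => [|k l IH] [|x s] /=.
  - by have -> : [set t : T | [::] = [::] :> seq S] = setT by apply/seteqP; split.
  - by have -> : [set t : T | [::] = x :: s] = set0 by apply/seteqP; split.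
  - by have -> : [set t | X k t :: [seq X k t | k <- l] = [::]] = set0 by apply/seteqP; split.
  - rewrite (_ : [set _ | _] =
      [set t | X k t = x] `&` [set t | [seq X k t | k <- l] = s]).
      by apply: measurableI; [exact: measurable_state|exact: IH].
    by apply/seteqP; split=> t /=; [case|case=> -> ->].
have -> : A = \bigcup_(s : seq S) (A `&` [set t | pre t = s]).
  by apply/seteqP; split=> [t At|t [s _ []] //]; exists (pre t).
apply: countable_bigcupT_measurable => // s.
have [[t [At <-]]|nA] := pselect (exists t, A t /\ pre t = s).
  rewrite (_ : _ `&` _ = [set t' | pre t' = pre t]) //.
  apply/seteqP; split=> [t' []//|t' e]; split=> //.
  by apply: hA At => k km; exact: (preE _ _ (esym e)).
rewrite (_ : _ `&` _ = set0) //; apply/seteqP; split=> // t [At e].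
by apply: nA; exists t.
Qed.

Lemma measurable_cyl x n : measurable (cyl x n).
Proof.
by apply: (@measurable_prefix n) => t t' e h k kn; rewrite -e // h.
Qed.

Lemma pr_cyl_extend x n s : pr (cyl (extend x n s) n.+1) = pr (cyl x n) * Q (x n) s.
Proof.
case: mcX => _ /(_ n (extend x n s)); rewrite -!/(cyl _ _) => h.
apply: EFin_inj; rewrite EFinM -!prE; [|exact: measurable_cyl..].
rewrite h extend_last; congr (P _ * (Q _ _)%:E)%E; last by rewrite /extend ltn_eqF.
apply/seteqP; split=> t /= c k kn; rewrite c // /extend ltn_eqF //.
Qed.

Lemma pr_cyl_null n (A : set T) : measurable A ->
  (forall x, pr (cyl x n `&` A) = 0) -> pr A = 0.
Proof.
move=> mA h.
have x0 : S.
  by apply: (X 0%N); apply: point.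
(* The type [nat -> S] need not be countable; finite lists padded with [x0] are, and they represent
   every prefix. *)
pose F (s : seq S) := cyl (nth x0 s) n `&` A.
apply: (@pr_null_bigcup _ _ _ _ _ F) => //.
- by move=> s; apply: measurableI => //; exact: measurable_cyl.
- move=> t At; exists [seq X k t | k <- iota 0 n.+1] => //; split=> // k kn.
  by rewrite (nth_map 0%N) ?size_iota // nth_iota.
- by move=> s; exact: h.
Qed.

(** * Chains observed through a finite family of moves *)

Section Moves.
Context {I : finType} {mv : S -> I -> S}.

Definition good_moves (good : S -> pred I) j n : set T :=
  [set t | forall i, (n <= i < n + j)%N ->
     exists2 v, good (X i t) v & X i.+1 t = mv (X i t) v].

Lemma measurable_good_moves good j n : measurable (good_moves good j n).
Proof.
apply: (@measurable_prefix (n + j)) => t t' e h i /andP[ni ij].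
by rewrite -!e ?(ltnW ij) //; apply: h; rewrite ni.
Qed.

(** Induction on [j], conditioning on the first move: [g] is a supersolution for the chain killed at
    its first step that is not a good move. *)
Lemma pr_good_moves_le good (g : nat -> S -> R) (B : set S) :
  (forall s, B s -> 1 <= g 0%N s) -> (forall s, 0 <= g 0%N s) ->
  (forall j s, \sum_(v | good s v) Q s (mv s v) * g j (mv s v) <= g j.+1 s) ->
  forall j n x,
  pr (cyl x n `&` good_moves good j n `&` [set t | B (X (n + j)%N t)])
    <= pr (cyl x n) * g j (x n).
Proof.
move=> g1 g0 gS j.
have mB m : measurable [set t | B (X m t)].
  by apply: (@measurable_prefix m) => t t' e /=; rewrite e.
have mE m i y : measurable (cyl y m `&` good_moves good i m `&` [set t | B (X (m + i)%N t)]).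
  by apply: measurableI => //; apply: measurableI;
    [exact: measurable_cyl|exact: measurable_good_moves].
elim: j => [|j IH] n x.
  have [Bx|nBx] := pselect (B (x n)).
    apply: (@le_trans _ _ (pr (cyl x n))).
      by apply: pr_le => //; [exact: measurable_cyl|move=> t [[]]].
    by rewrite ler_peMr ?pr_ge0 // g1.
  rewrite (_ : _ `&` _ = set0) ?pr_set0 ?mulr_ge0 ?pr_ge0 //.
  by apply/seteqP; split=> // t [[c _]] /=; rewrite addn0 c.
apply: (@le_trans _ _ (\sum_(v | good (x n) v) pr (cyl (extend x n (mv (x n) v)) n.+1
   `&` good_moves good j n.+1 `&` [set t | B (X (n.+1 + j)%N t)]))).
  apply: pr_bigcup_le => // t [[c h] b].
  have [|v gv ev] := h n; first by rewrite leqnn -addSnnS leq_addr.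
  move: gv ev; rewrite !(c n) // => gv ev; exists v => //; split; last by rewrite /= addSnnS.
  split; first by rewrite cyl_extend.
  by move=> i /andP[ni ij]; apply: h; rewrite (ltnW ni) -addSnnS.
apply: (@le_trans _ _ (pr (cyl x n) *
   (\sum_(v | good (x n) v) Q (x n) (mv (x n) v) * g j (mv (x n) v)))).
  rewrite mulr_sumr; apply: ler_sum => v _.
  by have := IH n.+1 (extend x n (mv (x n) v)); rewrite extend_last pr_cyl_extend mulrA.
by rewrite ler_wpM2l ?pr_ge0.
Qed.

Hypothesis mv_inj : forall s, injective (mv s).

Definition is_move i (t : T) : bool := `[< exists v, X i.+1 t = mv (X i t) v >].

Definition num_nonmoves j n (t : T) : nat := \sum_(n <= i < n + j) ~~ is_move i t.

Lemma is_move_prefix i t t' : X i t = X i t' -> X i.+1 t = X i.+1 t' ->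
  is_move i t = is_move i t'.
Proof. by rewrite /is_move => -> ->. Qed.

Lemma num_nonmoves_prefix j n t t' :
  (forall k, (k <= n + j)%N -> X k t = X k t') ->
  num_nonmoves j n t = num_nonmoves j n t'.
Proof.
move=> e; apply: eq_big_nat => i /andP[_ ij].
by rewrite (@is_move_prefix i t t') // e // ltnW.
Qed.

Lemma num_nonmovesS j n t :
  num_nonmoves j.+1 n t = (~~ is_move n t + num_nonmoves j n.+1 t)%N.
Proof. by rewrite /num_nonmoves addSnnS big_ltn // -addSnnS leq_addr. Qed.

Lemma measurable_num_nonmoves j n k : measurable [set t | (k < num_nonmoves j n t)%N].
Proof.
apply: (@measurable_prefix (n + j)) => t t' e /=.
by rewrite (num_nonmoves_prefix e).
Qed.

Lemma measurable_nonmove i : measurable [set t | ~~ is_move i t].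
Proof.
apply: (@measurable_prefix i.+1) => t t' e /=.
by rewrite (@is_move_prefix i t t') // e.
Qed.

(** Subadditivity would only bound this from below. The upper bound used later comes from the
    disjointness of the prolonged cylinders, that is, from the injectivity of [mv]. *)
Lemma pr_nonmove x n : pr (cyl x n `&` [set t | ~~ is_move n t]) =
  pr (cyl x n) * (1 - \sum_v Q (x n) (mv (x n) v)).
Proof.
set D := _ `&` _.
have mD : measurable D by apply: measurableI; [exact: measurable_cyl|exact: measurable_nonmove].
pose F v := cyl (extend x n (mv (x n) v)) n.+1.
have [|mU eU] := @pr_bigcup_fin _ _ _ P _ F (fun v => measurable_cyl _ _).
  move=> v w _ _ [t []]; rewrite /F !cyl_extend => -[_ /= ->] [_ /= /mv_inj].
  by [].
have cylE : cyl x n = D `|` \bigcup_v F v.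
  apply/seteqP; split=> t; last first.
    by case=> [[]|[v _]] //; rewrite /F cyl_extend => -[].
  move=> c; have [/asboolP[v ev]|nm] := boolP (is_move n t); [right|by left].
  by exists v => //; rewrite /F cyl_extend -(c n).
rewrite mulrBr mulr1 {1}cylE pr_setU //; last first.
  apply/disj_setPS => t [[c /= nm] [v _]]; rewrite /F cyl_extend => -[_ /= ev].
  by move/asboolP: nm; apply; exists v; rewrite (c n).
rewrite eU mulr_sumr -addrA [X in _ + X](_ : _ = 0) ?addr0 //.
by apply/eqP; rewrite subr_eq0; apply/eqP; apply: eq_bigr => v _; rewrite -pr_cyl_extend.
Qed.

(* [1 - dl] bounds the probability of ever leaving the moves, hence of each
   further exit, because the bound on [dl] is uniform in the state. *)
Lemma pr_num_nonmoves_le (dl : R) (g : S -> R) :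
  0 < dl -> (forall s, dl <= g s <= 1) ->
  (forall s, g s <= \sum_v Q s (mv s v) * g (mv s v)) ->
  forall j n k x,
  pr (cyl x n `&` [set t | (k < num_nonmoves j n t)%N])
    <= pr (cyl x n) * ((1 - dl) ^+ k * (1 - g (x n))).
Proof.
move=> dl0 g1 gS.
have mE m i k y : measurable (cyl y m `&` [set t | (k < num_nonmoves i m t)%N]).
  by apply: measurableI; [exact: measurable_cyl|exact: measurable_num_nonmoves].
have g1' s : 0 <= 1 - g s <= 1 - dl by have := g1 s; lra.
have dl1 k : 0 <= (1 - dl) ^+ k.
  have [t _] : exists t : T, True by exists point.
  by rewrite exprn_ge0 //; have := g1' (X 0%N t); lra.
elim=> [|j IH] n k x.
  rewrite (_ : _ `&` _ = set0) ?pr_set0 ?mulr_ge0 ?pr_ge0 //; first by case/andP: (g1' (x n)).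
  by apply/seteqP; split=> // t [_] /=; rewrite /num_nonmoves addn0 big_geq.
set D := cyl x n `&` [set t | ~~ is_move n t].
have mD : measurable D by apply: measurableI; [exact: measurable_cyl|exact: measurable_nonmove].
set E := cyl x n `&` _.
(* The first step is a non-move and counts for one, hence [k <=] for the remaining steps. *)
pose E' := D `&` [set t | (k <= num_nonmoves j n.+1 t)%N].
have mle : measurable [set t | (k <= num_nonmoves j n.+1 t)%N].
  case: k {E E'} => [|k]; last exact: measurable_num_nonmoves.
  by have -> : [set t | (0 <= num_nonmoves j n.+1 t)%N] = setT by apply/seteqP; split.
have mE' : measurable E' by exact: measurableI.
pose F v := cyl (extend x n (mv (x n) v)) n.+1 `&` [set t | (k < num_nonmoves j n.+1 t)%N].
have PE' : pr E' <= (1 - dl) ^+ k * pr D.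
  rewrite /E' in mE' *; case: k {E E' F} mle mE' => [|k] mle mE'.
    by rewrite expr0 mul1r; apply: pr_le => // t [].
  apply: (@pr_fiber_le _ _ _ _ _ (X n.+1)) => //; first exact: measurable_state.
  move=> s; rewrite setIAC.
  have [[t [[c nm] /= ts]]|nD] := pselect (exists t, (D `&` [set t | X n.+1 t = s]) t).
    have -> : D `&` [set t | X n.+1 t = s] = cyl (extend x n s) n.+1.
      rewrite cyl_extend; apply/seteqP; split=> [t' [[]] //|t' [c' e']]; split=> //; split=> //=.
      by rewrite (@is_move_prefix n t' t) // ?(c n) ?(c' n) // ts e'.
    apply: le_trans (IH _ _ _) _; rewrite mulrC ler_wpM2r ?pr_ge0 // exprSr.
    by rewrite ler_wpM2l //; case/andP: (g1' (extend x n s n.+1)).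
  rewrite (_ : D `&` _ = set0) ?set0I ?pr_set0 ?mulr0 //.
  by apply/seteqP; split=> // t Dt; apply: nD; exists t.
have PE : pr E <= pr E' + \sum_v pr (F v).
  apply: (@le_trans _ _ (pr (E' `|` \bigcup_v F v))).
    apply: pr_le => //; first exact: mE.
      apply: measurableU => //; apply: countable_bigcupT_measurable => // v.
      exact: mE.
    move=> t [c]; rewrite /= num_nonmovesS.
    have [/asboolP[v ev] /=|nm] := boolP (is_move n t).
      by rewrite add0n => h; right; exists v => //; split=> //; rewrite cyl_extend -(c n).
    by rewrite add1n ltnS => h; left.
  apply: (le_trans (pr_setU_le _ _ _)) => //.
    by apply: countable_bigcupT_measurable => // v; exact: mE.
  rewrite lerD2l; apply: pr_bigcup_le; last by move=> t [v _ Fv]; exists v.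
    by apply: countable_bigcupT_measurable => // v; exact: mE.
  by move=> v; exact: mE.
apply: (le_trans PE).
apply: (@le_trans _ _ ((1 - dl) ^+ k * (pr (cyl x n) * (1 - \sum_v Q (x n) (mv (x n) v)))
  + \sum_v pr (cyl x n) * Q (x n) (mv (x n) v) * ((1 - dl) ^+ k * (1 - g (mv (x n) v))))).
  apply: lerD; first by rewrite -pr_nonmove.
  apply: ler_sum => v _.
  by have := IH n.+1 k (extend x n (mv (x n) v)); rewrite extend_last pr_cyl_extend.
have -> : \sum_v pr (cyl x n) * Q (x n) (mv (x n) v) * ((1 - dl) ^+ k * (1 - g (mv (x n) v)))
  = pr (cyl x n) * (1 - dl) ^+ k * (\sum_v Q (x n) (mv (x n) v)
     - \sum_v Q (x n) (mv (x n) v) * g (mv (x n) v)).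
  rewrite -sumrB mulr_sumr; apply: eq_bigr => v _; ring.
rewrite [X in _ <= X]mulrA mulrCA mulrA -mulrDr ler_wpM2l ?mulr_ge0 ?pr_ge0 //.
(* The two sums of [Q] cancel, and subharmonicity of [g] is what remains. *)
by have := gS (x n); lra.
Qed.

(** Infinitely many non-moves exceed every [k] within a finite horizon, which has probability at
    most [(1 - dl) ^+ k]. *)
Lemma pr_nonmoves_io (dl : R) (g : S -> R) :
  0 < dl -> (forall s, dl <= g s <= 1) ->
  (forall s, g s <= \sum_v Q s (mv s v) * g (mv s v)) ->
  pr [set t | forall m, exists2 n, (m <= n)%N & ~~ is_move n t] = 0.
Proof.
move=> dl0 g1 gS; set A := [set t | _].
have mA : measurable A.
  rewrite (_ : A = \bigcap_m \bigcup_(n in [set n | (m <= n)%N]) [set t | ~~ is_move n t]).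
    apply: bigcap_measurableType => m _; apply: bigcup_measurable => n _.
    exact: measurable_nonmove.
  apply/seteqP; split=> [t h m _|t h m]; first by have [n] := h m; exists n.
  by have [//|n] := h m; exists n.
apply: (@pr_cyl_null 0%N) => // x.
have le k : pr (cyl x 0 `&` A) <= (1 - dl) ^+ k.
  apply: (@le_trans _ _ (pr (\bigcup_j (cyl x 0 `&` [set t | (k < num_nonmoves j 0 t)%N])))).
    apply: pr_le; first by apply: measurableI => //; exact: measurable_cyl.
      apply: bigcup_measurable => j _; apply: measurableI; first exact: measurable_cyl.
      exact: measurable_num_nonmoves.
    move=> t [c h]; suff [j kj] : exists j, (k < num_nonmoves j 0 t)%N by exists j.
    elim: k => [|k [j IH]].
      have [n _ nm] := h 0%N; exists n.+1.
      by rewrite /num_nonmoves add0n big_nat_recr //= nm addn1.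
    have [n jn nm] := h j; exists n.+1; apply: (leq_ltn_trans IH).
    rewrite /num_nonmoves !add0n big_nat_recr //= nm addn1 ltnS.
    by rewrite [X in (_ <= X)%N](@big_cat_nat _ _ _ j) //= leq_addr.
  apply: pr_nondecreasing.
  - move=> j; apply: measurableI; first exact: measurable_cyl.
    exact: measurable_num_nonmoves.
  - move=> j t [c h]; split=> //; apply: (leq_trans h).
    by rewrite /num_nonmoves !add0n big_nat_recr //= leq_addr.
  - move=> j; apply: (le_trans (pr_num_nonmoves_le dl0 g1 gS _ _ _ _)).
    rewrite mulrCA ler_piMr //; have := g1 (x 0%N); first by move=> ?; rewrite exprn_ge0 //; lra.
    move=> ?; rewrite mulr_ile1 ?pr_ge0 ?pr_le1 //; [lra|exact: measurable_cyl|lra].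
apply/eqP; rewrite eq_le pr_ge0 andbT.
have dl1 : `|1 - dl| < 1 by have := g1 (x 0%N); rewrite ltr_norml; lra.
have := cvg_geometric 1 dl1 => cg.
by apply: (cvgr_to_ge cg); near=> k; rewrite /geometric /= mul1r.
Unshelve. all: by end_near. Qed.

End Moves.
End MarkovChain.

(** * The nonlinear urn *)

Section Series.
Context {R : realType}.
Implicit Types (s : R) (c : nat -> R).

(* From [ln y <= y - 1] at [y = j / (j + 1)] one gets
   [(s - 1) (j + 1)^-s <= j^(1 - s) - (j + 1)^(1 - s)], which telescopes. *)
Lemma sum_powRN_le s n : 1 < s ->
  \sum_(0 <= j < n) j.+1%:R `^ (- s) <= s / (s - 1).
Proof.
move=> s1; have s0 : 0 < s - 1 by lra.
rewrite ler_pdivlMr //.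
(* The telescoping starts at [n = 1], where the bound is an equality. *)
suff [->|] : n = 0%N \/ (\sum_(0 <= j < n) j.+1%:R `^ (- s)) * (s - 1) <= s - n%:R `^ (1 - s).
- by rewrite big_geq // mul0r; lra.
- by have := powR_ge0 (n%:R : R) (1 - s); lra.
case: n => [|n]; [by left|right].
elim: n => [|n IH]; first by rewrite big_nat1 !powR1; lra.
rewrite big_nat_recr //= mulrDl; apply: (le_trans (lerD IH (lexx _))).
suff : n.+2%:R `^ (- s) * (s - 1) <= n.+1%:R `^ (1 - s) - n.+2%:R `^ (1 - s) :> R by lra.
have x0 : 0 < n.+1%:R :> R by rewrite ltr0n.
have -> : n.+2%:R = n.+1%:R + 1 :> R by rewrite -natr1.
move: n.+1%:R x0 => x x0; have x1 : 0 < x + 1 by lra.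
rewrite /powR !gt_eqF //.
have -> : expR ((1 - s) * ln x) = expR ((1 - s) * ln (x + 1)) * expR ((1 - s) * ln (x / (x + 1))).
  by rewrite -expRD ln_div // ?posrE //; congr expR; ring.
have -> : expR (- s * ln (x + 1)) = expR ((1 - s) * ln (x + 1)) / (x + 1).
  rewrite -[X in _ / X]lnK ?posrE // -expRN -expRD; congr expR; ring.
have e0 := expR_gt0 ((1 - s) * ln (x + 1)).
have h1 := expR_ge1Dx ((1 - s) * ln (x / (x + 1))).
have h2 : ln (x / (x + 1)) <= - (x + 1)^-1.
  have -> : x / (x + 1) = 1 + - (x + 1)^-1 by field; rewrite gt_eqF.
  by apply: le_ln1Dx; rewrite ltrN2 invf_lt1 // ltrDr.
have i0 : 0 < (x + 1)^-1 by rewrite invr_gt0.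
suff : (s - 1) * (x + 1)^-1 <= expR ((1 - s) * ln (x / (x + 1))) - 1 by nra.
by nra.
Qed.

(** The increments form an absolutely convergent series, dominated by [D / c j]. *)
Lemma cvg_increments c (B D : R) (a : nat -> R) :
  (forall n, \sum_(0 <= j < n) (c j)^-1 <= B) -> 0 <= D ->
  (forall j, `|a j.+1 - a j| <= D / c j) -> cvgn a.
Proof.
move=> cB D0 ha.
have : cvgn (series (fun j => a j.+1 - a j)).
  apply: normed_cvg; apply: nondecreasing_is_cvgn.
    by apply/nondecreasing_seqP => n; rewrite /= /series /= big_nat_recr //= lerDl.
  exists (D * B) => _ [n _ <-]; rewrite /series /=.
  apply: (@le_trans _ _ (\sum_(0 <= j < n) D / c j)); first exact: ler_sum.
  by rewrite -mulr_sumr ler_wpM2l.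
move=> cv; have -> : a = (fun n => a 0%N + series (fun j => a j.+1 - a j) n).
  by apply/funext => n; rewrite /series /= telescope_sumr // addrC subrK.
by apply: is_cvgD => //; exact: is_cvg_cst.
Qed.

End Series.

(** A crude bound that avoids square roots. *)
Lemma norm_le_of_sqr_le {R : realType} (u k : R) : 1 <= k -> u ^+ 2 <= k -> `|u| <= k.
Proof.
move=> k1; rewrite -real_normK ?num_real //.
by have := normr_ge0 u; case: (lerP `|u| 1); nra.
Qed.

(** * A bounded harmonic function for two colours *)

Section Spiral.
Context {R : realType}.
Variables (c : nat -> R) (B : R).
Hypothesis c_gt0 : forall j, 0 < c j.
Hypothesis c_sum : forall n, \sum_(0 <= j < n) (c j)^-1 <= B.
Implicit Types th : R.

(* Real and imaginary parts of [\prod_(j < x) (1 + i th / c j)]. *)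
Fixpoint spiral th (x : nat) : R * R :=
  if x is y.+1 then
    let: (a, b) := spiral th y in (a - th / c y * b, b + th / c y * a)
  else (1, 0).

Definition sqr_modulus th x : R := (spiral th x).1 ^+ 2 + (spiral th x).2 ^+ 2.

(* Real part of the product of [spiral th x] by the conjugate of [spiral th y]. *)
Definition pairing th x y : R :=
  (spiral th x).1 * (spiral th y).1 + (spiral th x).2 * (spiral th y).2.

Lemma spiralS th x : spiral th x.+1 =
  ((spiral th x).1 - th / c x * (spiral th x).2, (spiral th x).2 + th / c x * (spiral th x).1).
Proof. by rewrite /=; case: (spiral th x). Qed.

Lemma sqr_modulusS th x :
  sqr_modulus th x.+1 = sqr_modulus th x * (1 + (th / c x) ^+ 2).
Proof. by rewrite /sqr_modulus spiralS /=; ring. Qed.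

(** Let [W] be the complex product whose real part is [pairing]. The two weighted increments of [W]
    are [i th W] and [- i th W]. *)
Lemma pairing_harmonic th x y :
  c x * (pairing th x.+1 y - pairing th x y)
  + c y * (pairing th x y.+1 - pairing th x y) = 0.
Proof.
rewrite /pairing !spiralS /=; field; by rewrite !gt_eqF ?c_gt0.
Qed.

(** Cauchy-Schwarz in the plane; the defect is the square of a determinant. *)
Lemma pairing_sqr_le th x y :
  pairing th x y ^+ 2 <= sqr_modulus th x * sqr_modulus th y.
Proof.
rewrite /pairing /sqr_modulus; move: (spiral th x).1 (spiral th x).2.
move: (spiral th y).1 (spiral th y).2 => a b a' b'.
by have := sqr_ge0 (a * b' - b * a'); nra.
Qed.

Lemma sqr_modulus_ge1 th x : 1 <= sqr_modulus th x.
Proof.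
elim: x => [|x IH]; first by rewrite /sqr_modulus /= expr1n expr0n addr0.
by rewrite sqr_modulusS; have := sqr_ge0 (th / c x); nra.
Qed.

Lemma nondecreasing_sqr_modulus th : nondecreasing_seq (sqr_modulus th).
Proof.
apply/nondecreasing_seqP => x; rewrite sqr_modulusS.
by have := sqr_modulus_ge1 th x; have := sqr_ge0 (th / c x); nra.
Qed.

(** Each factor satisfies [1 + u ^+ 2 <= (1 + u) ^+ 2 <= expR (2 * u)] with [u = th / c x]. *)
Lemma sqr_modulus_le th x : 0 <= th -> sqr_modulus th x <= expR (2 * th * B).
Proof.
move=> th0; apply: (@le_trans _ _ (expR (2 * th * \sum_(0 <= j < x) (c j)^-1))).
  elim: x => [|x IH].
    by rewrite big_geq // mulr0 expR0 /sqr_modulus /= expr1n expr0n addr0.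
  rewrite sqr_modulusS big_nat_recr //= [X in expR X]mulrDr expRD.
  rewrite ler_pM ?(le_trans ler01 (sqr_modulus_ge1 _ _)) //.
    by rewrite addr_ge0 // sqr_ge0.
  have u0 : 0 <= th / c x by rewrite divr_ge0 // ltW.
  have -> : 2 * th * (c x)^-1 = th / c x + th / c x by ring.
  rewrite expRD.
  have h := expR_ge1Dx (th / c x).
  by nra.
by rewrite ler_expR ler_wpM2l // mulr_ge0.
Qed.

Lemma cvg_spiral th : 0 <= th ->
  cvgn (fun x => (spiral th x).1) /\ cvgn (fun x => (spiral th x).2).
Proof.
move=> th0; have M0 : 0 <= th * expR (2 * th * B) by rewrite mulr_ge0 // expR_ge0.
have K1 x := sqr_modulus_ge1 th x.
have KM x := sqr_modulus_le x th0.
have le u x : u ^+ 2 <= sqr_modulus th x -> `|th / c x * u| <= th * expR (2 * th * B) / c x.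
  move=> h; rewrite normrM ger0_norm ?divr_ge0 ?(ltW (c_gt0 _)) // [X in _ <= X]mulrAC.
  rewrite ler_wpM2l ?divr_ge0 ?(ltW (c_gt0 _)) //.
  by apply: norm_le_of_sqr_le; [exact: le_trans (K1 x) (KM x)|exact: le_trans h (KM x)].
split; apply: (cvg_increments c_sum M0) => j; rewrite spiralS /=.
  rewrite addrAC subrr add0r normrN; apply: le; rewrite /sqr_modulus lerDr; exact: sqr_ge0.
rewrite addrAC subrr add0r; apply: le; rewrite /sqr_modulus lerDl; exact: sqr_ge0.
Qed.

(** The spiral converges, and [k] is the squared modulus of its limit: the moduli increase to [k],
    and the pairing of two late points is close to it. *)
Lemma pairing_limit th : 0 <= th ->
  exists2 k : R, (forall x, sqr_modulus th x <= k) &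
    forall eps : R, 0 < eps -> exists N, forall x y, (N <= x)%N -> (N <= y)%N ->
      (1 - eps) * k <= pairing th x y.
Proof.
move=> th0; have [ca cb] := cvg_spiral th0.
set al := limn _ in ca; set be := limn _ in cb.
have ck : sqr_modulus th x @[x --> \oo] --> al ^+ 2 + be ^+ 2.
  by rewrite !expr2; apply: cvgD; apply: cvgM.
have Kk x : sqr_modulus th x <= al ^+ 2 + be ^+ 2.
  apply: (cvgr_to_ge ck); near=> y; apply: nondecreasing_sqr_modulus.
  by near: y; exact: nbhs_infty_ge.
exists (al ^+ 2 + be ^+ 2) => // eps e0.
have e4 : 0 < eps / 4 by lra.
have [N _ hN] : \forall x \near \oo,
    `|al - (spiral th x).1| < eps / 4 /\ `|be - (spiral th x).2| < eps / 4.
  by near=> x; split; near: x; [move/cvgrPdist_lt: ca|move/cvgrPdist_lt: cb]; apply.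
exists N => x y Nx Ny; have /= [ax bx] := hN x Nx; have /= [ay by_] := hN y Ny.
have := Kk x; have := Kk y; have := sqr_modulus_ge1 th x; have := sqr_modulus_ge1 th y.
rewrite /sqr_modulus /pairing.
move: ax ay bx by_; move: (spiral th x).1 (spiral th x).2.
move: (spiral th y).1 (spiral th y).2 => a b a' b'.
rewrite !ltr_norml => /andP[? ?] /andP[? ?] /andP[? ?] /andP[? ?].
set k := al ^+ 2 + be ^+ 2 => ? ? ? ?.
have k1 : 1 <= k by lra.
have mulb u v : u ^+ 2 <= k -> - (eps / 4) <= v <= eps / 4 -> - (k * (eps / 4)) <= u * v.
  move=> /(norm_le_of_sqr_le k1) uk; rewrite -ler_norml => vk; rewrite lerNl.
  by rewrite (le_trans (ler_norm _)) // normrN normrM ler_pM.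
have m1 := mulb al (a - al); have m2 := mulb be (b - be).
have m3 := mulb a (a' - al); have m4 := mulb b (b' - be).
have kal : al ^+ 2 <= k by rewrite /k lerDl sqr_ge0.
have kbe : be ^+ 2 <= k by rewrite /k lerDr sqr_ge0.
have ka : a ^+ 2 <= k by have := sqr_ge0 b; lra.
have kb : b ^+ 2 <= k by have := sqr_ge0 a; lra.
have {}m1 : - (k * (eps / 4)) <= al * (a - al) by apply: m1 => //; lra.
have {}m2 : - (k * (eps / 4)) <= be * (b - be) by apply: m2 => //; lra.
have {}m3 : - (k * (eps / 4)) <= a * (a' - al) by apply: m3 => //; lra.
have {}m4 : - (k * (eps / 4)) <= b * (b' - be) by apply: m4 => //; lra.
(* Expansion around the limit; each of the four error terms is at least [- (k * (eps / 4))]. *)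
have -> : a' * a + b' * b = k + al * (a - al) + be * (b - be) + a * (a' - al) + b * (b' - be).
  by rewrite /k; ring.
have -> : (1 - eps) * k = k - 4 * (k * (eps / 4)) by field.
move: m1 m2 m3 m4; move: (al * _) (be * _) (a * _) (b * _) (k * _) => u1 u2 u3 u4 z.
by move=> *; lra.
Unshelve. all: by end_near. Qed.

Lemma exists_harmonic (eps : R) (N0 : nat) : 0 < eps ->
  exists h : nat -> nat -> R, [/\
    forall x y, c x * (h x.+1 y - h x y) + c y * (h x y.+1 - h x y) = 0,
    forall x y, `|h x y| <= 1,
    forall x y, (x <= N0)%N || (y <= N0)%N -> `|h x y| <= eps &
    exists N, forall x y, (N <= x)%N -> (N <= y)%N -> 1 - eps <= h x y].
Proof.
move=> e0; pose th := c N0 / eps.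
have th0 : 0 <= th by rewrite divr_ge0 // ltW.
have [k Kk kN] := pairing_limit th0.
have k1 : 1 <= k by apply: le_trans (sqr_modulus_ge1 th 0) (Kk _).
have k0 : 0 < k by lra.
have K0 x : 0 < sqr_modulus th x by have := sqr_modulus_ge1 th x; lra.
have sym x y : pairing th x y = pairing th y x by rewrite /pairing mulrC [X in _ + X]mulrC.
have le m x y : 0 <= m -> pairing th x y ^+ 2 <= (m * k) ^+ 2 -> `|pairing th x y / k| <= m.
  move=> m0 h; rewrite normf_div (gtr0_norm k0) ler_pdivrMr //.
  by rewrite -(@ler_pXn2r _ 2) ?nnegrE ?mulr_ge0 // ?(ltW k0) // real_normK ?num_real.
exists (fun x y => pairing th x y / k); split.
- move=> x y; have := pairing_harmonic th x y.
  rewrite -!mulrBl !mulrA -mulrDl => ->; exact: mul0r.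
- move=> x y; apply: le => //; rewrite mul1r.
  apply: (le_trans (pairing_sqr_le _ _ _)).
  by rewrite expr2 ler_pM // ltW.
- have small x y : (x <= N0)%N -> `|pairing th x y / k| <= eps.
    move=> xN; apply: le; first exact: ltW.
    apply: (le_trans (pairing_sqr_le _ _ _)).
    have h1 := nondecreasing_sqr_modulus th xN.
    have h2 := Kk N0.+1; rewrite sqr_modulusS in h2.
    have cN0 := c_gt0 N0.
    have thE : th / c N0 = eps^-1 by rewrite /th; field; rewrite !gt_eqF.
    rewrite thE in h2; have := Kk y; have := K0 y; have := K0 x; have := K0 N0.
    have e2 : 0 < eps ^+ 2 by rewrite exprn_gt0.
    have h3 : sqr_modulus th x <= eps ^+ 2 * k.
      have : eps ^+ 2 * eps^-1 ^+ 2 = 1 by rewrite -exprMn divff ?expr1n // gt_eqF.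
      have := K0 N0; nra.
    by move=> *; rewrite exprMn [k ^+ 2]expr2 mulrA ler_pM // ltW.
  by move=> x y /orP[]; [exact: small|rewrite sym; exact: small].
- have [N hN] := kN _ e0; exists N => x y Nx Ny.
  by rewrite ler_pdivlMr //; exact: hN.
Qed.
End Spiral.

(** * Two counts of the urn cannot both diverge *)

Section Urn.
Context {R : realType} {V : finType}.
Variables (c : nat -> R) (B : R).
Hypothesis c_gt0 : forall j, 0 < c j.
Hypothesis c_sum : forall n, \sum_(0 <= j < n) (c j)^-1 <= B.
Implicit Types (eta xi : conf V) (f g : conf V -> R).

Definition total_weight eta : R := \sum_v c (eta v).

(* Markov semigroup of the urn with weights [c]. *)
Fixpoint urn j f eta : R :=
  if j is i.+1 then \sum_v c (eta v) / total_weight eta * urn i f (create eta v)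
  else f eta.

Lemma total_weight_gt0 eta (v : V) : 0 < total_weight eta.
Proof.
rewrite /total_weight (bigD1 v) //= ltr_wpDr //; apply: sumr_ge0 => w _; exact: ltW.
Qed.

Lemma urn_weight_ge0 eta v : 0 <= c (eta v) / total_weight eta.
Proof. by rewrite divr_ge0 // ltW // (total_weight_gt0 eta v). Qed.

Lemma urn_le j f g eta : (forall xi, f xi <= g xi) -> urn j f eta <= urn j g eta.
Proof.
move=> fg; elim: j eta => [|j IH] eta //=.
by apply: ler_sum => v _; rewrite ler_wpM2l ?urn_weight_ge0.
Qed.

Lemma urn_lin j (k : R) f g eta :
  urn j (fun xi => k * f xi + g xi) eta = k * urn j f eta + urn j g eta.
Proof.
elim: j eta => [|j IH] eta //=; rewrite mulr_sumr -big_split /=.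
by apply: eq_bigr => v _; rewrite IH; ring.
Qed.

(** Also applied to constant functions, to show that the semigroup fixes them. *)
Lemma urn_harmonic j f eta (v0 : V) :
  (forall xi, \sum_v c (xi v) * (f (create xi v) - f xi) = 0) -> urn j f eta = f eta.
Proof.
move=> hf; elim: j eta => [|j IH] eta //=.
transitivity (\sum_v (c (eta v) / total_weight eta * f eta
   + c (eta v) * (f (create eta v) - f eta) / total_weight eta)).
  by apply: eq_bigr => v _; rewrite IH; ring.
rewrite big_split /= -!mulr_suml hf mul0r addr0 divff ?mul1r //.
by rewrite gt_eqF // (total_weight_gt0 eta v0).
Qed.

(** Draws of other colours leave both counts unchanged, so only the terms [a] and [b] survive. *)
Lemma urn_pair_harmonic (h : nat -> nat -> R) a b xi : a != b ->
  (forall x y, c x * (h x.+1 y - h x y) + c y * (h x y.+1 - h x y) = 0) ->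
  \sum_v c (xi v) * (h (create xi v a) (create xi v b) - h (xi a) (xi b)) = 0.
Proof.
move=> ab hh; rewrite (bigD1 a) //= (bigD1 b) 1?eq_sym //= big1 => [|v /andP[va vb]].
  by rewrite !ffunE !eqxx (negPf ab) eq_sym (negPf ab) addr0.
by rewrite !ffunE eq_sym (negPf va) eq_sym (negPf vb) subrr mulr0.
Qed.

Definition both_ge (a b : V) N eta : R := ((N <= eta a)%N && (N <= eta b)%N)%:R.

(* With [h] harmonic, at most [eps] in modulus unless both colours exceed [N0],
   and at least [1 - eps] once both exceed [N], the indicators satisfy
   [(2 - eps) 1_N <= h + eps + 1_N0]; applying the semigroup turns [h] into its
   small initial value. *)
Lemma urn_both_ge_step a b eta (eps : R) N0 : a != b -> 0 < eps -> (eta a <= N0)%N ->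
  exists2 N, (N0 < N)%N & forall j,
    (2 - eps) * urn j (both_ge a b N) eta <= 2 * eps + urn j (both_ge a b N0.+1) eta.
Proof.
move=> ab e0 aN; have [h [harm h1 hsmall [N hN]]] := exists_harmonic c_gt0 c_sum N0 e0.
exists (maxn N N0.+1); first by rewrite leq_max leqnn orbT.
move=> j; set N' := maxn _ _.
pose H xi := h (xi a) (xi b).
have hH : urn j H eta = H eta.
  by apply: (urn_harmonic _ _ a) => xi; exact: urn_pair_harmonic.
have h2 : urn j (fun=> eps) eta = eps.
  by apply: (urn_harmonic _ _ a) => xi; rewrite big1 // => v _; rewrite subrr mulr0.
have : H eta <= eps by apply: le_trans (ler_norm _) _; apply: hsmall; rewrite aN.
rewrite -hH => Hle.
(* Trivial coefficients and summands put both sides into the shape of [urn_lin]. *)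
suff : urn j (fun xi => (2 - eps) * both_ge a b N' xi + 0) eta <=
   urn j (fun xi => 1 * H xi + (1 * both_ge a b N0.+1 xi + eps)) eta.
  rewrite (urn_lin _ _ (both_ge a b N') (fun=> 0)).
  rewrite (urn_lin _ 1 H (fun xi => 1 * both_ge a b N0.+1 xi + eps)).
  rewrite (urn_lin _ 1 (both_ge a b N0.+1) (fun=> eps)) h2.
  have -> : urn j (fun=> 0) eta = 0.
    by apply: (urn_harmonic _ _ a) => xi; rewrite big1 // => v _; rewrite subrr mulr0.
  lra.
apply: urn_le => xi; rewrite /both_ge /N' !geq_max.
have := h1 (xi a) (xi b); have := hsmall (xi a) (xi b); have := hN (xi a) (xi b).
rewrite -/(H xi) !ler_norml (leqNgt _ N0) (leqNgt (xi b) N0).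
case: (N <= xi a)%N; case: (N <= xi b)%N; case: (N0 < xi a)%N; case: (N0 < xi b)%N => //=.
all: move=> A1 A2 /andP[A3 A4]; try (have {}A1 := A1 isT isT);
  try (have /andP[A5 A6] := A2 isT); lra.
Qed.

Lemma urn_both_ge_small a b eta (eps : R) : a != b -> 0 < eps ->
  exists N, forall j, urn j (both_ge a b N) eta <= eps.
Proof.
move=> ab e0.
have [k [ke]] : exists k, (2 / 3) ^+ k <= eps.
  have cg : (2 / 3 : R) ^+ k @[k --> \oo] --> (0 : R).
    by apply: cvg_expr; rewrite ger0_norm; lra.
  have [k _ hk] : \forall k \near \oo, (2 / 3) ^+ k <= eps by exact: (cvgr_le (0 : R)) cg _ e0.
  by exists k; apply: hk => /=.
suff : exists2 N, (eta a < N)%N & forall j, urn j (both_ge a b N) eta <= (2 / 3) ^+ k.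
  by case=> N _ hN; exists N => j; exact: le_trans (hN j) ke.
elim: k {ke} => [|k [N0 aN0 IH]].
  exists (eta a).+1 => // j; rewrite expr0.
  have <- : urn j (fun=> 1) eta = 1.
    by apply: (urn_harmonic _ _ a) => xi; rewrite big1 // => v _; rewrite subrr mulr0.
  by apply: urn_le => xi; rewrite /both_ge lern1 leq_b1.
set t := (2 / 3) ^+ k in IH.
have t0 : 0 < t by apply: exprn_gt0; lra.
have t1 : t <= 1 by apply: exprn_ile1; lra.
case: N0 aN0 IH => // N0 aN0 IH.
(* With [eps = t / 8] and [t <= 1], the new bound is at most [(5 / 4 * t) / (15 / 8)], which is
   [2 / 3 * t]. *)
have [|N NN0 hN] := @urn_both_ge_step a b eta (t / 8) N0 ab _ aN0; first by lra.
exists N; first exact: leq_ltn_trans NN0.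
move=> j; have := hN j; have := IH j; rewrite exprSr -/t.
set g := urn _ _ _; set g' := urn _ _ _ => ? ?.
have g0 : 0 <= g'.
  have <- : urn j (fun=> 0) eta = 0.
    by apply: (urn_harmonic _ _ a) => xi; rewrite big1 // => v _; rewrite subrr mulr0.
  by apply: urn_le => xi; rewrite /both_ge ler0n.
nra.
Qed.
End Urn.

(** * The zero range process *)

Section Weights.
Context {R : realType} {V : finType}.
Variables (e : rel V) (p q r : R).
Implicit Types (eta : conf V) (v w : V).

Definition removal eta v : R :=
  removal_weight q (eta v) + (degree e v)%:R * removal_weight r (eta v).

Lemma removal_ge0 eta v : 0 <= removal eta v.
Proof. by rewrite addr_ge0 ?mulr_ge0 ?removal_weight_ge0. Qed.

Lemma zrp_ZE eta : zrp_Z e p q r eta =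
  total_weight (creation_weight p) eta + \sum_v removal eta v.
Proof. by rewrite /zrp_Z /total_weight -big_split /=; apply: eq_bigr => v _; rewrite addrA. Qed.

Lemma total_le_zrp_Z eta : total_weight (creation_weight p) eta <= zrp_Z e p q r eta.
Proof. by rewrite zrp_ZE lerDl sumr_ge0 // => v _; exact: removal_ge0. Qed.

Lemma degree_gt0 v : simple_connected_graph e -> #|V| <> 1%N -> (0 < degree e v)%N.
Proof.
case=> _ _ conn V1; have [u uv] : exists u, u != v.
  apply: contrapT => nu; apply: V1; apply/eqP/fintype1P; exists v => u.
  by apply/eqP; apply: contra_notT nu => ?; exists u.
have /connectP[[|w s] /=] := conn v u; first by move=> _ uv'; rewrite uv' eqxx in uv.
by case/andP=> evw _ _; apply/card_gt0P; exists w.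
Qed.

Lemma le_mass eta v : (eta v <= mass eta)%N.
Proof. by rewrite /mass (bigD1 v) //= leq_addr. Qed.

Lemma creation_le_removal eta v : simple_connected_graph e ->
  (#|V| = 1%N -> p <= 1 + q) -> p <= 1 + Num.max q r -> (0 < eta v)%N ->
  creation_weight p (eta v) <= (mass eta)%:R * removal eta v.
Proof.
move=> hG hV hp v0.
have k1 : 1 <= (eta v)%:R :> R by rewrite ler1n.
have kM : (eta v)%:R <= (mass eta)%:R :> R by rewrite ler_nat le_mass.
rewrite /removal /creation_weight /removal_weight gtn_eqF //.
have pow a : p <= 1 + a -> (eta v)%:R `^ p <= (mass eta)%:R * (eta v)%:R `^ a.
  move=> pa; apply: (@le_trans _ _ ((eta v)%:R `^ (1 + a))); first exact: ler_powR.
  rewrite powRD; last by rewrite pnatr_eq0 gtn_eqF ?implybT.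
  by rewrite powRr1 // ler_wpM2r ?powR_ge0.
have q0 := powR_ge0 (eta v)%:R q; have r0 := powR_ge0 (eta v)%:R r.
have M0 : 0 <= (mass eta)%:R :> R by [].
have [pq|pq] := leP p (1 + q).
  by apply: (le_trans (pow _ pq)); rewrite ler_wpM2l // lerDl mulr_ge0.
have pr : p <= 1 + r by move: hp; rewrite maxEle; case: ifP => // _; lra.
apply: (le_trans (pow _ pr)); rewrite ler_wpM2l // -[X in X <= _]add0r lerD //.
(* Here [1 + q < p], so [hV] excludes a single vertex and the degree is at least 1. *)
rewrite ler_peMl // ler1n; apply: degree_gt0 => // V1.
by have := hV V1; lra.
Qed.

(** Let [N] be the creation weight of the occupied sites, [C] that of all sites, [D] the removal
    weight and [M] the mass. Then [N <= M * D] and [N <= C] give [(M + 1) * N <= M * (C + D)]. *)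
Lemma sum_positive_creation_le eta : simple_connected_graph e ->
  (#|V| = 1%N -> p <= 1 + q) -> p <= 1 + Num.max q r -> V ->
  \sum_(v | (0 < eta v)%N) zrp_kernel e p q r eta (create eta v)
    <= (mass eta)%:R / (mass eta).+1%:R.
Proof.
move=> hG hV hp v0.
under eq_bigr do rewrite zrp_kernel_create.
rewrite -mulr_suml ler_pdivrMr ?(zrp_Z_gt0 e p q r eta v0) //.
rewrite mulrAC ler_pdivlMr ?ltr0n // -natr1 mulrDr mulr1.
set N := \sum_(v | _) _.
have : N <= (mass eta)%:R * \sum_v removal eta v.
  rewrite [X in _ * X](bigID (fun v => 0 < eta v)%N) /= mulrDr.
  rewrite -[X in X <= _]addr0 lerD //.
    by rewrite mulr_sumr; apply: ler_sum => v ev; exact: creation_le_removal.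
  by rewrite mulr_ge0 // sumr_ge0 // => v _; exact: removal_ge0.
have : N <= total_weight (creation_weight p) eta.
  rewrite /total_weight [X in _ <= X](bigID (fun v => 0 < eta v)%N) /= lerDl.
  by apply: sumr_ge0 => v _; rewrite ltW // creation_weight_gt0.
have M0 : 0 <= (mass eta)%:R :> R by [].
rewrite zrp_ZE => h1 h2.
have : N * (mass eta)%:R <= (mass eta)%:R * total_weight (creation_weight p) eta.
  by rewrite mulrC ler_wpM2l.
lra.
Qed.

(** The summand 1 is the term [j = 0], by the convention on creation at an empty site. *)
Lemma sum_creation_weightV_le n : 1 < p ->
  \sum_(0 <= j < n) (creation_weight p j)^-1 <= 1 + p / (p - 1).
Proof.
move=> p1; have pp : 0 <= p / (p - 1) by rewrite divr_ge0; lra.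
case: n => [|n]; first by rewrite big_geq //; lra.
rewrite big_nat_recl //= invr1 lerD2l.
apply: le_trans (sum_powRN_le n p1); apply: ler_sum => j _.
by rewrite /creation_weight /= powRN.
Qed.

(** Raising the exponent to some [rho >= 0] makes the power monotone in its base, so that every site
    can be compared with the fullest one. *)
Lemma removal_weight_le (a rho : R) n k : a <= rho -> 0 <= rho -> (n <= k)%N ->
  removal_weight a n <= k%:R `^ rho.
Proof.
move=> ar r0 nk; rewrite /removal_weight; case: eqP => [_|/eqP n0]; first exact: powR_ge0.
apply: (@le_trans _ _ (n%:R `^ rho)); first by rewrite ler_powR // ler1n lt0n.
by apply: ge0_ler_powR; rewrite ?nnegrE // ler_nat.
Qed.

(** Let [k] be the largest count, [n] the number of sites and [s = p - rho]. Removals weigh at most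
    [n * (1 + n) * k ^ rho], creations at least [k ^ rho * k ^ s], and the mass plus one is at most
    [(1 + n) * k]. *)
Lemma exists_summable_removal : 1 + Num.max (Num.max q r) 0 < p -> V ->
  exists s k : R, [/\ 1 < s, 0 <= k & forall eta, \sum_v removal eta v <=
    k * (mass eta).+1%:R `^ (- s) * total_weight (creation_weight p) eta].
Proof.
set rho := Num.max _ _ => hp v0.
have [rq rr r0] : [/\ q <= rho, r <= rho & 0 <= rho].
  by split; rewrite /rho !le_max lexx ?orbT.
pose n : R := #|V|%:R; pose s := p - rho.
have n0 : 0 <= n by [].
exists s, (n * (1 + n) * (1 + n) `^ s); split; first by rewrite /s; lra.
  by rewrite !mulr_ge0 ?powR_ge0 ?addr_ge0.
move=> eta; have [v _ vmax] := arg_maxnP (fun v => eta v) (erefl (xpredT v0)).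
have [k0|k0] := posnP (eta v).
  rewrite big1 => [|w _].
    rewrite !mulr_ge0 ?powR_ge0 ?addr_ge0 //.
    by apply: sumr_ge0 => w _; rewrite ltW // creation_weight_gt0.
  have : eta w = 0%N by have := vmax w isT; lia.
  by rewrite /removal /removal_weight => ->; rewrite mulr0 addr0.
set k : R := (eta v)%:R; have k1 : 1 <= k by rewrite ler1n.
have kp x : 0 < k `^ x by rewrite powR_gt0 //; lra.
have removal_le : \sum_w removal eta w <= n * (1 + n) * k `^ rho.
  apply: (@le_trans _ _ (\sum_(w : V) (1 + n) * k `^ rho)).
    apply: ler_sum => w _; rewrite mulrDl mul1r lerD //.
      by apply: removal_weight_le => //; exact: vmax.
    rewrite ler_pM ?removal_weight_ge0 //.
      by rewrite ler_nat; exact: max_card.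
    by apply: removal_weight_le => //; exact: vmax.
  by rewrite sumr_const -mulr_natl mulrA.
have total_ge : k `^ rho * k `^ s <= total_weight (creation_weight p) eta.
  have kne : k != 0 by rewrite gt_eqF //; lra.
  rewrite -powRD; last by rewrite kne implybT.
  rewrite /s addrCA subrr addr0 /total_weight (bigD1 v) //=.
  rewrite [creation_weight p (eta v)]/creation_weight gtn_eqF //.
  by rewrite lerDl; apply: sumr_ge0 => w _; rewrite ltW // creation_weight_gt0.
have mass_le : (mass eta).+1%:R `^ s <= (1 + n) `^ s * k `^ s.
  rewrite -powRM ?addr_ge0 //.
  have s0 : 0 <= s by rewrite /s; lra.
  apply: ge0_ler_powR; rewrite ?nnegrE ?s0 ?mulr_ge0 ?addr_ge0 //.
  rewrite -natr1 addrC mulrDl mul1r lerD // /n /k -natrM ler_nat /mass.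
  by rewrite -sum_nat_const; apply: leq_sum => w _; exact: vmax.
apply: (le_trans removal_le).
rewrite powRN; set m := _.+1%:R `^ s in mass_le *.
have m0 : 0 < m by rewrite powR_gt0 // ltr0n.
rewrite [X in _ <= X]mulrAC ler_pdivlMr //.
rewrite -!mulrA ler_wpM2l // ler_wpM2l ?addr_ge0 //.
apply: (le_trans (ler_wpM2l (ltW (kp rho)) mass_le)).
by rewrite mulrCA ler_wpM2l ?powR_ge0.
Qed.

(** [g] is a partial product of the factors [u j], divided by a bound [L] on all of them. A creation
    multiplies it by [u (mass eta)], which makes up for the removal part of [zrp_Z]. *)
Lemma exists_subharmonic : 1 + Num.max (Num.max q r) 0 < p -> V ->
  exists (dl : R) (g : conf V -> R), [/\ 0 < dl, forall eta, dl <= g eta <= 1 &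
    forall eta, g eta <= \sum_v zrp_kernel e p q r eta (create eta v) * g (create eta v)].
Proof.
move=> hp v0; have [s [k [s1 k0 rem]]] := exists_summable_removal hp v0.
pose u j := 1 + k * j.+1%:R `^ (- s).
have u1 j : 1 <= u j by rewrite lerDl mulr_ge0 ?powR_ge0.
pose Pi n := \prod_(0 <= j < n) u j.
have Pi1 n : 1 <= Pi n.
  elim: n => [|n IH]; first by rewrite /Pi big_geq.
  by rewrite /Pi big_nat_recr //= -[X in X <= _]mul1r ler_pM.
pose L := expR (k * (s / (s - 1))); have L0 : 0 < L by exact: expR_gt0.
have PiL n : Pi n <= L.
  apply: (@le_trans _ _ (expR (k * \sum_(0 <= j < n) j.+1%:R `^ (- s)))).
    elim: n => [|n IH]; first by rewrite /Pi !big_geq // mulr0 expR0.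
    rewrite /Pi !big_nat_recr //= [X in expR X]mulrDr expRD ler_pM ?expR_ge1Dx //.
      exact: le_trans ler01 (Pi1 n).
    exact: le_trans ler01 (u1 n).
  by rewrite ler_expR ler_wpM2l // sum_powRN_le.
exists L^-1, (fun eta => Pi (mass eta) / L); split; first by rewrite invr_gt0.
  move=> eta; rewrite ler_pdivrMr // mul1r PiL andbT.
  by rewrite -[X in X <= _]mul1r ler_wpM2r // invr_ge0 ltW.
move=> eta; have Z0 := zrp_Z_gt0 e p q r eta v0.
under eq_bigr do rewrite zrp_kernel_create mass_create.
rewrite -!mulr_suml -/(total_weight (creation_weight p) eta).
rewrite [X in _ <= X]mulrA ler_wpM2r ?invr_ge0 ?(ltW L0) //.
rewrite /Pi big_nat_recr //= -/(Pi _) mulrCA ler_peMr ?(le_trans ler01 (Pi1 _)) //.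
rewrite mulrAC ler_pdivlMr // mul1r zrp_ZE /u mulrDr mulr1 lerD2l.
by apply: (le_trans (rem eta)); rewrite mulrC.
Qed.

(** Removals only enlarge the normalization, so each creation is at most as likely as in the urn.
    The shape is that of the hypothesis of [pr_good_moves_le]. *)
Lemma kernel_urn_le j (f : conf V -> R) eta : V -> (forall xi, 0 <= f xi) ->
  \sum_(v | xpredT v) zrp_kernel e p q r eta (create eta v)
     * urn (creation_weight p) j f (create eta v)
    <= urn (creation_weight p) j.+1 f eta.
Proof.
move=> v0 f0 /=; apply: ler_sum => v _; rewrite zrp_kernel_create.
have c0 := creation_weight_gt0 p; have T0 := total_weight_gt0 c0 eta v0.
rewrite ler_wpM2r //.
  have <- : urn (creation_weight p) j (fun=> 0) (create eta v) = 0.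
    by apply: (urn_harmonic c0 _ _ v0) => xi; rewrite big1 // => w _; rewrite subrr mulr0.
  exact: urn_le.
rewrite ler_wpM2l ?(ltW (c0 _)) // lef_pV2 ?posrE ?(zrp_Z_gt0 e p q r eta v0) //.
exact: total_le_zrp_Z.
Qed.

End Weights.

(** The sequence is constant once it attains its maximum. *)
Lemma nondecreasing_nat_stationary (f : nat -> nat) B :
  (forall n, (f n <= f n.+1)%N) -> (forall n, (f n <= B)%N) ->
  exists N, forall n, (N <= n)%N -> f n = f N.
Proof.
move=> nd fB; have [|k kB|k /asboolP[N fN] kmax] :=
  @ex_maxnP (fun k => `[< exists n, f n = k >]) B.
- by exists (f 0%N); apply/asboolP; exists 0%N.
- by move: kB => /asboolP[n <-].
have mono m n : (m <= n)%N -> (f m <= f n)%N.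
  exact: (homo_leq leqnn (fun _ _ _ => @leq_trans _ _ _) nd).
exists N => n Nn; apply/eqP; rewrite eqn_leq (mono _ _ Nn) andbT fN.
by apply: kmax; apply/asboolP; exists n.
Qed.

Lemma uniform_rank (V : finType) (Q : V -> nat -> Prop) :
  (forall v, exists N, forall n, (N <= n)%N -> Q v n) ->
  exists N, forall v n, (N <= n)%N -> Q v n.
Proof.
move=> /choice[N hN]; exists (\max_v N v)%N => v n Nn; apply: hN.
by apply: leq_trans Nn; exact: leq_bigmax.
Qed.

(** * Almost sure behaviour of the process *)

Section Process.
Context {R : realType} {V : finType} {e : rel V} {p q r : R} {d : measure_display}
  {T : measurableType d} {P : probability T R} {H : nat -> T -> conf V}.
Hypothesis hG : simple_connected_graph e.
Hypothesis hH : zero_range_process e p q r P H.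
Local Notation pr := (pr P).

Let mcH : markov_chain P (zrp_kernel e p q r) H := hH.1.

Definition positive_sites : conf V -> pred V := fun eta v => (0 < eta v)%N.
Definition all_sites : conf V -> pred V := fun=> xpredT.

Definition good_from (good : conf V -> pred V) m : set T :=
  \bigcap_j good_moves (mv := @create V) (X := H) good j m.

Lemma good_fromP good m t : good_from good m t <->
  forall n, (m <= n)%N -> exists2 v, good (H n t) v & H n.+1 t = create (H n t) v.
Proof.
split=> [h n mn|h j _ n /andP[mn _]]; last exact: h.
by apply: (h (n - m).+1 I); lia.
Qed.

Lemma measurable_good_from good m : measurable (good_from good m).
Proof. by apply: bigcap_measurableType => j _; exact: (measurable_good_moves mcH). Qed.

Lemma CreatE : Creat H = \bigcup_m good_from all_sites m.
Proof.
apply/seteqP; split=> t [m].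
  by move=> h; exists m => //; apply/good_fromP => n /h[v]; exists v.
by move=> _ /good_fromP h; exists m => n /h[v]; exists v.
Qed.

Lemma measurable_Creat : measurable (Creat H).
Proof. by rewrite CreatE; apply: bigcup_measurable => m _; exact: measurable_good_from. Qed.

Lemma good_from_nondecreasing good m t v n :
  good_from good m t -> (m <= n)%N -> (H n t v <= H n.+1 t v)%N.
Proof.
by move=> /good_fromP h /h[w _ ->]; rewrite ffunE; case: ifP => _; [exact: leqnSn|].
Qed.

(** When only creations occur, an occupied site stays occupied. So each site is filled from empty at
    most once, and all these times lie before some [N]. *)
Lemma Creat_positive t : Creat H t -> exists m, good_from positive_sites m t.
Proof.
rewrite CreatE => -[m _ gt]; have nd v n := good_from_nondecreasing v gt (n := n).
have [N hN] : exists N, forall v n, (N <= n)%N ->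
    forall n', (m <= n')%N -> (0 < H n' t v)%N -> (0 < H n t v)%N.
  apply: uniform_rank => v.
  have [[N mN Npos]|none] := pselect (exists2 N, (m <= N)%N & (0 < H N t v)%N).
    exists N => n Nn _ _ _; rewrite -(subnKC Nn); elim: (n - N)%N => [|k IH].
      by rewrite addn0.
    by rewrite addnS (leq_trans IH) // nd // (leq_trans mN) // leq_addr.
  by exists 0%N => n _ n' mn' pos; case: none; exists n'.
exists (maxn m N); apply/good_fromP => n; rewrite geq_max => /andP[mn Nn].
move/good_fromP: gt => /(_ n mn)[v _ ev]; exists v => //.
by apply: (hN v n Nn n.+1); rewrite ?(leqW mn) // ev ffunE eqxx.
Qed.

Lemma pr_Creat0 : V -> (#|V| = 1%N -> p <= 1 + q) -> p <= 1 + Num.max q r ->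
  pr (Creat H) = 0.
Proof.
move=> v0 hV hp.
apply: (@pr_null_bigcup _ _ _ _ _ (good_from positive_sites)).
- exact: measurable_Creat.
- by move=> m; exact: measurable_good_from.
- by move=> t /Creat_positive[m]; exists m.
move=> m; apply: (pr_cyl_null mcH (n := m)); first exact: measurable_good_from.
(* The telescoped product of the one-step bounds. The case [j = 0] is separate because the quotient
   [0 / 0] is 0 for an empty configuration. *)
move=> x; pose g j (eta : conf V) : R :=
  if j is _.+1 then (mass eta)%:R / (mass eta + j)%:R else 1.
have gS j eta : \sum_(v | positive_sites eta v)
    zrp_kernel e p q r eta (create eta v) * g j (create eta v) <= g j.+1 eta.
  have gE v : g j (create eta v) = (mass eta).+1%:R / (mass eta + j.+1)%:R.
    rewrite /g mass_create; case: j => [|j]; last by rewrite addSnnS.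
    by rewrite addn1 divff // pnatr_eq0.
  under eq_bigr do rewrite gE.
  rewrite -mulr_suml /g.
  have -> : (mass eta)%:R / (mass eta + j.+1)%:R =
      (mass eta)%:R / (mass eta).+1%:R * ((mass eta).+1%:R / (mass eta + j.+1)%:R) :> R.
    by rewrite mulrA mulfVK // pnatr_eq0.
  by rewrite ler_wpM2r ?divr_ge0 // sum_positive_creation_le.
have le j : pr (cyl (X := H) x m `&` good_from positive_sites m) * (j.+1)%:R <= (mass (x m))%:R.
  have := pr_good_moves_le mcH (B := setT) (g := g) (fun _ _ => lexx 1)
    (fun _ => ler01) gS j.+1 m x.
  set A := _ `&` _ => hA.
  have : pr (cyl (X := H) x m `&` good_from positive_sites m)
      <= (mass (x m))%:R / (mass (x m) + j.+1)%:R.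
    apply: le_trans (le_trans hA _).
      apply: pr_le.
      - apply: measurableI; [exact: (measurable_cyl mcH)|exact: measurable_good_from].
      - apply: measurableI; last first.
          by have -> : [set t | setT (H (m + j.+1)%N t)] = setT by apply/seteqP.
        by apply: measurableI; [exact: (measurable_cyl mcH)|exact: (measurable_good_moves mcH)].
      - by move=> t [c h]; split=> //; split=> //; exact: h.
    rewrite /g ler_piMl ?divr_ge0 //; apply: pr_le1; exact: (measurable_cyl mcH).
  rewrite ler_pdivlMr; last by rewrite ltr0n addnS.
  by apply: le_trans; rewrite ler_wpM2l ?pr_ge0 // ler_nat leq_addl.
(* A positive probability would violate [le] as soon as [j.+1] exceeds the mass divided by it. *)
apply/eqP; rewrite eq_le pr_ge0 andbT leNgt; apply/negP => pos.
have := le (Num.truncn ((mass (x m))%:R / pr (cyl (X := H) x m `&` good_from positive_sites m))).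
by rewrite leNgt mulrC -ltr_pdivrMr // truncnS_gt.
Qed.

Lemma pr_Creat1 : V -> 1 + Num.max (Num.max q r) 0 < p -> pr (~` Creat H) = 0.
Proof.
move=> v0 hp; have [dl [g [dl0 g1 gS]]] := exists_subharmonic e hp v0.
apply/eqP; rewrite eq_le pr_ge0 andbT.
rewrite -(pr_nonmoves_io mcH (@create_inj V) dl0 g1 gS).
have -> // : ~` Creat H = [set t | forall m, exists2 n, (m <= n)%N &
   ~~ is_move (mv := @create V) (X := H) n t].
apply/seteqP; split=> t /=.
  move=> nC m; apply: contrapT => h; apply: nC; exists m => n mn.
  by apply/asboolP; apply: contra_notT h => nm; exists n.
by move=> h [m hm]; have [n mn /asboolP] := h m; apply; exact: hm.
Qed.

(** Counts never decrease on this event, so a common time for both thresholds expresses that both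
    counts are unbounded. *)
Definition two_unbounded (a b : V) m : set T :=
  good_from all_sites m `&` [set t | forall N, exists n, (m <= n)%N /\
    (N <= H n t a)%N /\ (N <= H n t b)%N].

Lemma measurable_two_unbounded a b m : measurable (two_unbounded a b m).
Proof.
apply: measurableI; first exact: measurable_good_from.
rewrite (_ : mkset _ = \bigcap_N \bigcup_n [set t | (m <= n)%N /\
    (N <= H n t a)%N /\ (N <= H n t b)%N]).
  apply: bigcap_measurableType => N _; apply: bigcup_measurable => n _.
  by apply: (measurable_prefix mcH (m := n)) => t t' /(_ n (leqnn n)) /= ->.
apply/seteqP; split=> t /= h N; first by move=> _; have [n] := h N; exists n.
by have [n _] := h N I; exists n.
Qed.

Lemma pr_two_unbounded a b m : 1 < p -> a != b -> pr (two_unbounded a b m) = 0.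
Proof.
move=> p1 ab; apply: (pr_cyl_null mcH (n := m)); first exact: measurable_two_unbounded.
move=> x; apply/eqP; rewrite eq_le pr_ge0 andbT.
apply/ler_addgt0Pr => eps e0; rewrite add0r.
have [N hN] := urn_both_ge_small (creation_weight_gt0 p)
  (fun n => sum_creation_weightV_le n p1) (x m) ab e0.
(* Keeping [good_from], which concerns the whole future, makes [F] nondecreasing in [J]. It is
   weakened to [good_moves] only to bound each [F J]. *)
pose F J := cyl (X := H) x m `&` good_from all_sites m `&`
  [set t | (N <= H (m + J)%N t a)%N && (N <= H (m + J)%N t b)%N].
have mF J : measurable (F J).
  apply: measurableI.
    by apply: measurableI; [exact: (measurable_cyl mcH)|exact: measurable_good_from].
  by apply: (measurable_prefix mcH (m := m + J)) => t t' /(_ _ (leqnn _)) /= ->.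
apply: (@le_trans _ _ (pr (\bigcup_J F J))).
  apply: pr_le; last 1 first.
  - move=> t [c [h /(_ N)[n [mn [Na Nb]]]]]; exists (n - m)%N => //.
    by split=> //; rewrite /= subnKC // Na.
  - by apply: measurableI; [exact: (measurable_cyl mcH)|exact: measurable_two_unbounded].
  - exact: bigcup_measurable.
apply: pr_nondecreasing => // J.
  move=> t [[c h] /= /andP[Na Nb]]; split=> //=.
  by rewrite addnS !(leq_trans _ (good_from_nondecreasing _ h _)) // leq_addr.
pose B := [set eta : conf V | (N <= eta a)%N && (N <= eta b)%N].
have both0 eta : 0 <= both_ge (R := R) a b N eta by [].
have B1 eta : B eta -> 1 <= both_ge a b N eta :> R by rewrite /B /both_ge /= => ->.
have le := pr_good_moves_le mcH (good := all_sites)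
  (g := fun j => urn (creation_weight p) j (both_ge a b N)) B1 both0
  (fun j s => kernel_urn_le e p q r j s a both0) J m x.
apply: (@le_trans _ _ (pr (cyl (X := H) x m) * urn (creation_weight p) J (both_ge a b N) (x m))).
  apply: le_trans le; apply: pr_le => //.
    apply: measurableI.
      by apply: measurableI; [exact: (measurable_cyl mcH)|exact: (measurable_good_moves mcH)].
    by apply: (measurable_prefix mcH (m := m + J)) => t t' /(_ _ (leqnn _)) /= ->.
  by move=> t [[c h] Nab]; split=> //; split=> //; exact: h.
apply: le_trans (hN J); rewrite ler_piMl //.
  have <- : urn (creation_weight p) J (fun=> 0) (x m) = 0.
    by apply: (urn_harmonic (creation_weight_gt0 p) _ _ a) => xi;
      rewrite big1 // => w _; rewrite subrr mulr0.
  by apply: urn_le => //; exact: creation_weight_gt0.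
by apply: pr_le1; exact: (measurable_cyl mcH).
Qed.

Definition monopoly w m : set T :=
  [set t | forall n, (m <= n)%N -> H n.+1 t w = (H n t w).+1 /\
     forall v, v != w -> H n.+1 t v = H n t v].

Lemma measurable_monopoly w m : measurable (monopoly w m).
Proof.
rewrite (_ : monopoly w m = \bigcap_(n in [set n | (m <= n)%N])
  [set t | H n.+1 t w = (H n t w).+1 /\ forall v, v != w -> H n.+1 t v = H n t v]) //.
apply: bigcap_measurableType => n _.
by apply: (measurable_prefix mcH (m := n.+1)) => t t' et /=; rewrite !et.
Qed.

(** Uniqueness is automatic: past both starting times, the count of a second such site would have to
    grow and to stay constant. *)
Lemma MonE : Mon H = \bigcup_w \bigcup_m monopoly w m.
Proof.
apply/seteqP; split=> t; first by case=> w [[m h] _]; exists w => //; exists m.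
case=> w _ [m _ h]; exists w; split; first by exists m.
move=> w' [m' h']; apply: contrapT => /nesym/eqP ww'.
have [_ /(_ _ ww')] := h _ (leq_maxl m m').
by have [-> _ /esym/n_Sn] := h' _ (leq_maxr m m').
Qed.

Lemma measurable_Mon : measurable (Mon H).
Proof.
rewrite MonE; apply: countable_bigcupT_measurable => [|w]; first exact: countableP.
by apply: bigcup_measurable => m _; exact: measurable_monopoly.
Qed.

(** The mass tends to infinity, so some count is unbounded. Every other count is then bounded, hence
    eventually constant, and late creations can only take place at that site. *)
Lemma Mon_of_Creat t : V -> Creat H t ->
  (forall a b m, a != b -> ~ two_unbounded a b m t) -> Mon H t.
Proof.
move=> v0; rewrite CreatE MonE => -[m _ gt] two.
have nd v n := good_from_nondecreasing v gt (n := n).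
have mono v k l : (m <= k)%N -> (k <= l)%N -> (H k t v <= H l t v)%N.
  move=> mk kl; rewrite -(subnKC kl); elim: (l - k)%N => [|j IH]; first by rewrite addn0.
  by rewrite addnS (leq_trans IH) // nd // (leq_trans mk) // leq_addr.
have step n : (m <= n)%N -> exists v, H n.+1 t = create (H n t) v.
  by move=> mn; move/good_fromP: gt => /(_ n mn)[v _ ev]; exists v.
have [w wN] : exists w, forall N, exists2 n, (m <= n)%N & (N <= H n t w)%N.
  apply: contrapT => nw.
  have /choice[B hB] : forall v, exists N, forall n, (m <= n)%N -> (H n t v <= N)%N.
    move=> v; apply: contrapT => nv; apply: nw; exists v => N.
    apply: contrapT => nN; apply: nv; exists N => n mn.
    by rewrite leqNgt; apply/negP => lt; apply: nN; exists n => //; exact: ltnW.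
  have massE k : mass (H (m + k)%N t) = (mass (H m t) + k)%N.
    elim: k => [|k IH]; first by rewrite !addn0.
    have [v ev] := step _ (leq_addr k m).
    by rewrite addnS ev mass_create IH addnS.
  have := massE (\sum_v B v).+1.
  have : (mass (H (m + (\sum_v B v).+1)%N t) <= \sum_v B v)%N.
    by apply: leq_sum => v _; apply: hB; exact: leq_addr.
  by move=> /[swap] ->; rewrite addnS ltnNge leq_addl.
have [N hN] : exists N, forall v n, (N <= n)%N -> v != w -> (m <= n)%N -> H n.+1 t v = H n t v.
  apply: uniform_rank => v.
  have [->|vw] := eqVneq v w; first by exists 0%N.
  have [B hB] : exists B, forall n, (m <= n)%N -> (H n t v <= B)%N.
    apply: contrapT => nB; apply: (two v w m vw); split=> // N.
    have [n1 mn1 wn1] := wN N.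
    have [n2 mn2 vn2] : exists2 n, (m <= n)%N & (N <= H n t v)%N.
      apply: contrapT => nN; apply: nB; exists N => n mn.
      by rewrite leqNgt; apply/negP => lt; apply: nN; exists n => //; exact: ltnW.
    exists (maxn n1 n2); split; first by rewrite leq_max mn1.
    by split; [apply: leq_trans vn2 _|apply: leq_trans wn1 _];
      apply: mono => //; rewrite ?leq_maxl ?leq_maxr.
  have [N hN] := @nondecreasing_nat_stationary (fun k => H (m + k)%N t v) B
    (fun k => eq_ind _ (fun x => (_ <= H x t v)%N) (nd v _ (leq_addr _ _)) _ (esym (addnS m k)))
    (fun k => hB _ (leq_addr _ _)).
  exists (m + N)%N => n Nn _ mn.
  rewrite -(subnKC mn) -addnS !hN //; lia.
exists w => //; exists (maxn m N) => // n; rewrite geq_max => /andP[mn Nn].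
have [v ev] := step n mn; have [vw|vw] := eqVneq v w.
  by rewrite ev vw; split=> [|u /negPf uw]; rewrite ffunE ?eqxx // uw.
by have := hN v n Nn vw mn; rewrite ev ffunE eqxx => /esym/n_Sn.
Qed.

Lemma pr_Mon1 : V -> 1 + Num.max (Num.max q r) 0 < p -> pr (~` Mon H) = 0.
Proof.
move=> v0 hp; have p1 : 1 < p.
  by apply: le_lt_trans hp; rewrite lerDl le_max lexx orbT.
(* A countable cover of the exceptional paths; [None] stands for the failure of [Creat]. *)
pose F (i : option (V * V * nat)) : set T :=
  if i is Some (a, b, m) then (if a != b then two_unbounded a b m else set0)
  else ~` Creat H.
apply: (@pr_null_bigcup _ _ _ _ _ F).
- by apply: measurableC; exact: measurable_Mon.
- case=> [[[a b] m]|]; last by apply: measurableC; exact: measurable_Creat.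
  by rewrite /F; case: ifP => // _; exact: measurable_two_unbounded.
- move=> t nM; have [Ct|nC] := pselect (Creat H t); last by exists None.
  apply: contrapT => nF; apply: nM; apply: Mon_of_Creat => // a b m ab two.
  by apply: nF; exists (Some (a, b, m)); rewrite //= ab.
- case=> [[[a b] m]|]; last exact: pr_Creat1.
  by rewrite /F; case: ifP => [ab|_]; [exact: pr_two_unbounded|exact: pr_set0].
Qed.

(** Without sites, [conf0] is the only configuration, and the process does not start there almost
    surely. *)
Lemma nonempty_sites : inhabited V.
Proof.
apply: contrapT => nV.
have : P [set t | H 0%N t = conf0 V] = 0%E := hH.2.
have -> : [set t | H 0%N t = conf0 V] = setT.
  by apply/seteqP; split=> t // _; apply/ffunP => v; case: nV.
by rewrite probability_setT => /eqP; rewrite onee_eq0.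
Qed.

End Process.

(* If the graph has a single vertex, there are no jumps and r plays no role, so
   that the first claim is only true when p <= 1 + q. *)
Theorem theorem1p1 (R : realType) (V : finType) (e : rel V)
    (hG : simple_connected_graph e) (p q r : R)
    (d : measure_display) (T : measurableType d) (P : probability T R)
    (H : nat -> T -> conf V) (hH : zero_range_process e p q r P H) :
  ((#|V| = 1%N -> p <= 1 + q) ->
     p <= 1 + Num.max q r -> P (Creat H) = 0%E) /\
  (1 + Num.max (Num.max q r) 0 < p ->
     P (Creat H) = 1%E /\ P (Mon H) = 1%E).
Proof.
have [v0] := nonempty_sites hH.
have mC := measurable_Creat hH; have mM := measurable_Mon hH.
have compl A : measurable A -> pr P (~` A) = 0 -> P A = 1%E.
  move=> mA A0; rewrite -[A]setCK probability_setC; last exact: measurableC.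
  by rewrite (prE P (measurableC mA)) A0 sube0.
split=> [hV hp|hp]; first by rewrite (prE P mC) (pr_Creat0 hG hH).
by split; apply: compl => //; [exact: pr_Creat1 hH v0 hp|exact: pr_Mon1 hH v0 hp].
Qed.
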